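(* Let $n\ge 25$ and $t\ge 1$. Among all graphs in $Cact(n;t)$, the cactus with the third-minimum degree resistance distance is $G_4$. That is, $D_R(G^0(n;t))<D_R(G_5)<D_R(G_4)$, where $G^0(n;t)$ and $G_5$ are the graphs with the minimum and the second-minimum degree resistance distance in $Cact(n;t)$, and every $G\in Cact(n;t)$ that is not isomorphic to any of $G^0(n;t)$, $G_5$, $G_4$ satisfies $D_R(G)>D_R(G_4)$.
   Context: All graphs are finite and simple. A cactus is a graph in which every block is either an edge or a cycle. $Cact(n;t)$ is the set of connected cacti with $n$ vertices and $t$ cycles. For a connected graph $G$, $R_G(u,v)$ is the resistance distance between $u$ and $v$, i.e. the effective resistance between $u$ and $v$ when every edge of $G$ is replaced by a unit resistor, and $d_G(u)$ is the degree of $u$. The degree resistance distance is $$D_R(G)=\sum_{\{u,v\}\subseteq V(G)}[d_G(u)+d_G(v)]\,R_G(u,v).$$ $G^0(n;t)$ is the graph on $n$ vertices consisting of $t$ triangles and $n-2t-1$ pendent edges, all sharing exactly one common vertex $v_1$. $G_5$ is the graph on $n$ vertices consisting of one 4-cycle $C_4$, $t-1$ triangles and $n-2t-2$ pendent edges, all sharing exactly one common vertex $v_1$. $G_4$ is the graph on $n$ vertices obtained from $G^0(n-1;t)$ by attaching one new pendent vertex to a vertex $v_2\ne v_1$ lying on one of the triangles. (Equivalently, one pendent edge of $G^0(n;t)$ is moved from $v_1$ to a triangle vertex $v_2\neq v_1$.) *)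

(* Defs.v *)
From HB Require Import structures.
From mathcomp Require Import all_boot all_order all_algebra.
Set Implicit Arguments.
Unset Strict Implicit.
Unset Printing Implicit Defensive.
Import Order.TTheory GRing.Theory Num.Theory.

Record sgraph := SGraph {
  vertex :> finType;
  adj : rel vertex;
  adj_sym : symmetric adj;
  adj_irr : irreflexive adj }.

Notation "x -- y" := (adj x y) (at level 30).

Definition isomorphic (G H : sgraph) : Prop :=
  exists2 f : G -> H, bijective f & forall x y, (f x -- f y) = (x -- y).

Section Cactus.
Variable G : sgraph.
Implicit Types (S : {set G}) (c : seq G).

Definition deg (u : G) : nat := #|[set v | u -- v]|.

Definition connected_set S : bool :=
  [forall x in S, forall y in S,
     connect [rel a b | [&& a \in S, b \in S & a -- b]] x y].

Definition connected_graph : bool := connected_set [set: G].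

(* Blocks are represented by their vertex sets: a block, being a maximal
   connected subgraph without cut vertex, is always an induced subgraph. *)
Definition nonseparable S : bool :=
  [&& S != set0, connected_set S & [forall x in S, connected_set (S :\ x)]].

Definition block S : bool := maxset nonseparable S.

(* The vertices of c, in cyclic order, form a cycle of G; the same cycle is
   represented by all rotations and reflections of c. *)
Definition is_cycle c : bool := (2 < size c) && ucycleb (@adj G) c.

Definition cycle_edges c : {set {set G}} := [set [set x; next c x] | x in c].

(* The cycles of G as subgraphs, i.e. as edge sets; a duplicate-free sequence
   has at most #|G| items, so the bound on k loses nothing. *)
Definition cycles : {set {set {set G}}} :=
  [set E | [exists k : 'I_#|G|.+1, exists c : k.-tuple G,
              is_cycle c && (E == cycle_edges c)]].

Definition edge_block S : Prop := exists x y, x -- y /\ S = [set x; y].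

(* The subgraph induced by S is a (chordless) cycle. *)
Definition cycle_block S : Prop :=
  exists c, [/\ is_cycle c, S = [set x in c] &
    forall x y, x \in S -> y \in S -> x -- y -> [set x; y] \in cycle_edges c].

Definition cactus : Prop := forall S, block S -> edge_block S \/ cycle_block S.

Definition Cact (n t : nat) : Prop :=
  [/\ connected_graph, cactus, #|G| = n & #|cycles| = t].

End Cactus.

Section Resistance.
Variables (R : realFieldType) (G : sgraph).
Implicit Types u v x y : G.
Local Open Scope ring_scope.

Definition laplacian : 'M[R]_#|G| :=
  \matrix_(i, j) ((deg (enum_val i))%:R *+ (i == j)
                  - (enum_val i -- enum_val j)%:R).

(* Unit current entering the network at u and leaving it at v. *)
Definition unit_current u v : 'rV[R]_#|G| :=
  delta_mx 0 (enum_rank u) - delta_mx 0 (enum_rank v).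

(* Node potentials under this current, with unit resistors on the edges: a
   solution of Kirchhoff's equations, i.e. of p *m laplacian = unit_current u v;
   see potential_kirchhoff and resistance_unique. *)
Definition potential u v x : R :=
  (unit_current u v *m pinvmx laplacian) 0 (enum_rank x).

Definition resistance u v : R := potential u v u - potential u v v.

(* Each unordered pair {u, v} of distinct vertices is counted once. *)
Definition DR : R :=
  \sum_(u : G) \sum_(v : G | (enum_rank u < enum_rank v)%N)
    (deg u + deg v)%:R * resistance u v.

Definition kirchhoff u v (p : G -> R) : Prop :=
  forall x, \sum_(y | x -- y) (p x - p y) = (x == u)%:R - (x == v)%:R.

Lemma laplacianE (p : 'rV[R]_#|G|) x :
  (p *m laplacian) 0 (enum_rank x)
  = \sum_(y | x -- y) (p 0 (enum_rank x) - p 0 (enum_rank y)).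
Proof.
pose q y := p 0 (enum_rank y).
have -> : (p *m laplacian) 0 (enum_rank x)
    = \sum_y q y * ((deg y)%:R *+ (y == x) - (y -- x)%:R).
  rewrite mxE (reindex (@enum_rank G)) /=; last exact/onW_bij/enum_rank_bij.
  by apply: eq_bigr => y _; rewrite mxE !enum_rankK (inj_eq enum_rank_inj).
have -> : \sum_(y | x -- y) (q x - q y)
    = q x * (deg x)%:R - \sum_(y | x -- y) q y.
  by rewrite sumrB sumr_const mulr_natr /deg cardsE.
have -> : \sum_(y | x -- y) q y = \sum_y q y * (y -- x)%:R.
  rewrite big_mkcond; apply: eq_bigr => y _; rewrite adj_sym.
  by case: (y -- x); rewrite ?mulr1 ?mulr0.
have -> : q x * (deg x)%:R = \sum_y q y * ((deg y)%:R *+ (y == x)).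
  rewrite (bigD1 x) //= eqxx big1 ?addr0 // => y /negbTE ->.
  by rewrite mulr0n mulr0.
by rewrite -sumrB; apply: eq_bigr => y _; rewrite mulrBr.
Qed.

Lemma laplacian_tr : laplacian^T = laplacian.
Proof.
apply/matrixP=> i j; rewrite !mxE adj_sym eq_sym.
by case: eqP => [->|].
Qed.

Lemma unit_currentE u v x :
  unit_current u v 0 (enum_rank x) = (x == u)%:R - (x == v)%:R.
Proof. by rewrite !mxE eqxx /= !(inj_eq enum_rank_inj). Qed.

Lemma kirchhoffE u v (p : 'rV[R]_#|G|) :
  kirchhoff u v (fun x => p 0 (enum_rank x)) <->
  p *m laplacian = unit_current u v.
Proof.
split=> [Kp | Lp x]; last by rewrite -laplacianE Lp unit_currentE.
by apply/rowP=> i; rewrite -(enum_valK i) laplacianE unit_currentE Kp.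
Qed.

Lemma harmonic_const (p : 'rV[R]_#|G|) u v :
  connected_graph G -> p *m laplacian = 0 ->
  p 0 (enum_rank u) = p 0 (enum_rank v).
Proof.
pose q x := p 0 (enum_rank x); move=> Gc Lp.
have H x : \sum_(y | x -- y) (q x - q y) = 0 by rewrite -laplacianE Lp mxE.
have E1 : \sum_x \sum_(y | x -- y) q x * (q x - q y) = 0.
  by rewrite big1 // => x _; rewrite -mulr_sumr H mulr0.
have E2 : \sum_x \sum_(y | x -- y) q y * (q x - q y) = 0.
  rewrite (exchange_big_dep xpredT) //= big1 // => y _.
  rewrite -mulr_sumr; apply/eqP; rewrite mulf_eq0; apply/orP; right.
  rewrite -oppr_eq0 -sumrN -[X in _ == X](H y); apply/eqP.
  by apply: eq_big => [x|x _]; rewrite ?opprB // adj_sym.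
have E : \sum_x \sum_(y | x -- y) (q x - q y) ^+ 2 = 0.
  transitivity (0 - 0 : R); last exact: subrr.
  rewrite -[X in _ = X - _]E1 -[X in _ = _ - X]E2 -sumrB; apply: eq_bigr => x _.
  by rewrite -sumrB; apply: eq_bigr => y _; rewrite expr2 mulrBl.
have adjq x y : x -- y -> q x = q y.
  move=> xy; apply/eqP; rewrite -subr_eq0 -sqrf_eq0.
  have ge0 z : 0 <= \sum_(y | z -- y) (q z - q y) ^+ 2.
    by apply: sumr_ge0 => w _; apply: sqr_ge0.
  move/eqP: E; rewrite psumr_eq0 // => /allP/(_ x (mem_index_enum _)) /=.
  rewrite psumr_eq0 => [|w _]; last exact: sqr_ge0.
  by move=> /allP/(_ y (mem_index_enum _)) /=; rewrite xy.
have := forallP Gc u; rewrite in_setT /= => /forallP/(_ v); rewrite in_setT /=.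
case/connectP=> s sP ->; rewrite -!/(q _).
elim: s u sP => //= y s IHs x /andP[/and3P[_ _ /adjq ->]]; exact: IHs.
Qed.

(* On a connected graph the potential above satisfies Kirchhoff's law, and any
   other potential that does so gives the same effective resistance. *)
Lemma potential_kirchhoff u v :
  connected_graph G -> kirchhoff u v (potential u v).
Proof.
move=> Gc; apply/kirchhoffE/mulmxKpV; rewrite submxE; apply/eqP/rowP=> j.
rewrite mulmxBl -!rowE !mxE; apply/eqP; rewrite subr_eq0; apply/eqP.
have := @harmonic_const (row j (cokermx laplacian)^T) u v Gc.
rewrite !mxE; apply; rewrite -row_mul -[X in _ *m X]laplacian_tr -trmx_mul.
by rewrite mulmx_coker trmx0 row0.
Qed.

Lemma resistance_unique u v (p : G -> R) :
  connected_graph G -> kirchhoff u v p -> resistance u v = p u - p v.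
Proof.
move=> Gc Kp; pose r : 'rV[R]_#|G| := \row_i p (enum_val i).
have rE x : r 0 (enum_rank x) = p x by rewrite mxE enum_rankK.
have Lr : r *m laplacian = unit_current u v.
  apply/kirchhoffE => x; rewrite -(Kp x).
  by apply: eq_bigr => y _; rewrite !rE.
have /kirchhoffE Ls := @potential_kirchhoff u v Gc.
set s := _ *m pinvmx _ in Ls.
have := @harmonic_const (s - r) u v Gc.
have sB x : (s - r) 0 (enum_rank x) = s 0 (enum_rank x) - p x.
  by rewrite mxE [X in _ + X]mxE rE.
rewrite mulmxBl Ls Lr subrr !sB => /(_ erefl)/eqP; rewrite subr_eq => /eqP E.
rewrite /resistance /potential -/s E.
by rewrite addrAC [X in X + _]addrAC subrr sub0r addrC.
Qed.

End Resistance.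

Section ExtremalGraphs.

(* Graph on {0, ..., n-1} whose edges are the pairs i < j such that f i j. *)
Section OfNat.
Variables (n : nat) (f : nat -> nat -> bool).

Definition nat_adj : rel 'I_n :=
  [rel i j : 'I_n | ((i < j) && f i j) || ((j < i) && f j i)].

Lemma nat_adj_sym : symmetric nat_adj.
Proof. by move=> i j; apply: orbC. Qed.

Lemma nat_adj_irr : irreflexive nat_adj.
Proof. by move=> i; rewrite /nat_adj /= ltnn. Qed.

Definition nat_graph : sgraph := SGraph nat_adj_sym nat_adj_irr.
End OfNat.

(* In all three graphs v_1 is the vertex 0. *)

(* Triangles {0, 2k-1, 2k} for 1 <= k <= t, pendent vertices 2t+1, ..., n-1. *)
Definition G0_edge (t i j : nat) : bool :=
  (i == 0) || [&& odd i, j == i.+1 & j <= t.*2].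

Definition G0 (n t : nat) : sgraph := nat_graph n (G0_edge t).

(* 4-cycle 0, 1, 2, 3, triangles {0, 2k, 2k+1} for 2 <= k <= t, pendent
   vertices 2t+2, ..., n-1. *)
Definition G5_edge (t i j : nat) : bool :=
  [|| (i == 0) && (j != 2),
      (i == 1) && (j == 2),
      (i == 2) && (j == 3)
    | [&& 4 <= i, ~~ odd i, j == i.+1 & j <= t.*2.+1]].

Definition G5 (n t : nat) : sgraph := nat_graph n (G5_edge t).

(* G0 (n-1) t on {0, ..., n-2}, with a new vertex n-1 attached to the triangle
   vertex v_2 = 1. *)
Definition G4_edge (n t i j : nat) : bool :=
  if j == n.-1 then i == 1 else G0_edge t i j.

Definition G4 (n t : nat) : sgraph := nat_graph n (G4_edge n t).

End ExtremalGraphs.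

(* Main.v *)
Require Import Defs.
From mathcomp Require Import all_boot all_order all_algebra.
From mathcomp Require Import zify ring lra.
Set Implicit Arguments.
Unset Strict Implicit.
Unset Printing Implicit Defensive.
Import Order.TTheory GRing.Theory Num.Theory.

(** Resistances add up along the blocks of a cactus, so [DR] splits into a sum
    over blocks.  Say that a vertex [a] of a block [B] carries [x_a] vertices
    and [c_a] cycles beyond [B].  A block of [k] vertices with resistances [r]
    contributes a term depending only on [k], [n] and [t], plus the excess
      [2 * sum_(a, b in B) r a b * (x_a + c_a) * x_b >= 0],
    which vanishes iff at most one vertex of [B] carries anything.  With [n] and
    [t] fixed, the minimum thus has only triangles and pendent edges, all at a
    common vertex.  The cheapest deviations are one pendent 4-cycle, costing
    [(5n + t - 31)/3], and one vertex hung on a triangle, costing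
    [(8n + 4t - 36)/3]; any other cactus exceeds the minimum by more than the
    latter, two 4-cycles being the critical case ([n >= 2t + 3] and [n >= 25]
    give [2(5n + t - 31) > 8n + 4t - 36]). *)

(** * Nonseparable sets and blocks *)

(** Both directions rest on one interface, [gated]: a family of edges and induced cycles together
    with a gate map. A cactus supplies it through its blocks. The explicit graphs supply it by
    formulas; that their sets are the blocks, and how many cycles there are, is then deduced from
    the gates alone. Additivity of resistance needs no network reduction: the sum of the block
    resistances between gates is checked against Kirchhoff's equations, which determine the
    effective resistance. The bilinear excess arises when both ends of a pair are grouped by their
    gates in [B]: the degrees over the fiber of [a] add up to [inner_deg B + 2 x_a + 2 c_a], the
    fiber of [b] has [x_b + 1] vertices, and in the product all but [2 (x_a + c_a) x_b] depends on
    totals only. One obstacle remains at the end: enumerating a cactus with a given block pattern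
    produces an extremal graph with some number [t'] of triangles or cycles, not visibly [t]. The
    two are identified by the handshake identity, since degrees transport along an isomorphism more
    easily than sets of cycles. *)

Section Nonseparable.
Variable G : sgraph.
Implicit Types (S T B : {set G}) (x y z : G) (c p : seq G).

Definition inrel S : rel G := [rel a b | [&& a \in S, b \in S & a -- b]].

Lemma inrel_sym S : connect_sym (inrel S).
Proof. by apply: sym_connect_sym => x y; rewrite /inrel /= adj_sym andbCA. Qed.

Lemma connected_setP S :
  reflect {in S &, forall x y, connect (inrel S) x y} (connected_set S).
Proof.
apply: (iffP forall_inP) => [Sc x y xS yS | Sc x xS].
  by have /forall_inP := Sc x xS; apply.
by apply/forall_inP => y yS; apply: Sc.
Qed.

Lemma connected_root S x :
  {in S, forall y, connect (inrel S) x y} -> connected_set S.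
Proof.
move=> Sx; apply/connected_setP=> y z yS zS.
by apply: connect_trans (Sx z zS); rewrite inrel_sym Sx.
Qed.

Lemma connected_setU S T z :
  z \in S -> z \in T -> connected_set S -> connected_set T ->
  connected_set (S :|: T).
Proof.
move=> zS zT /connected_setP Sc /connected_setP Tc.
apply: (@connected_root _ z) => y /setUP[yS|yT].
  apply: connect_sub (Sc z y zS yS) => a b /and3P[aS bS ab].
  by apply: connect1; rewrite /inrel /= !inE aS bS ab.
apply: connect_sub (Tc z y zT yT) => a b /and3P[aS bS ab].
by apply: connect1; rewrite /inrel /= !inE aS bS ab !orbT.
Qed.

Lemma connected_set1 x : connected_set [set x].
Proof. by apply: (@connected_root _ x) => y /set1P->. Qed.

Lemma connected_set2 x y : x -- y -> connected_set [set x; y].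
Proof.
move=> xy; apply: (@connected_root _ x) => z /set2P[]-> //.
by apply: connect1; rewrite /inrel /= !inE !eqxx xy orbT.
Qed.

Lemma connected_path x p :
  path (@adj G) x p -> connected_set [set y in x :: p].
Proof.
elim: p x => [|y p IHp] x /= => [_|/andP[xy /IHp pc]].
  by rewrite (_ : [set y in [:: x]] = [set x]) ?connected_set1 //;
     apply/setP=> z; rewrite !inE.
have -> : [set z in [:: x, y & p]] = [set x; y] :|: [set z in y :: p].
  by apply/setP=> z; rewrite !inE; case: (z == x); case: (z == y).
by apply: (@connected_setU _ _ y); rewrite ?inE ?eqxx ?orbT ?connected_set2.
Qed.

Lemma cycle_nonseparable c : is_cycle c -> nonseparable [set x in c].
Proof.
case/andP=> c2 /andP[cc cu]; apply/and3P; split.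
- by case: c c2 {cc cu} => // x p _; apply/set0Pn; exists x; rewrite !inE eqxx.
- case: c cc {c2 cu} => [_|x p /= ].
    by apply/connected_setP=> x y; rewrite inE.
  by rewrite rcons_path => /andP[/connected_path].
apply/forall_inP=> x; rewrite inE => xc.
(* Rotated so as to start at [x], the cycle without [x] is the path [p]. *)
have [i p Dp] := rot_to xc.
have : cycle (@adj G) (rot i c) by rewrite rot_cycle.
have : uniq (rot i c) by rewrite rot_uniq.
rewrite Dp /= rcons_path => /andP[xp _] /andP[pP _].
have -> : [set y in c] :\ x = [set y in p].
  apply/setP=> y; rewrite !inE -(mem_rot i) Dp inE.
  by case: eqP => [->|]; rewrite //= (negbTE xp).
case: p pP {Dp xp} => [_|y p /= /andP[_ /connected_path//]].
by apply/connected_setP=> z y; rewrite inE.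
Qed.

Lemma edge_nonseparable x y : x -- y -> nonseparable [set x; y].
Proof.
move=> xy; have nxy : x != y by apply: contraTneq xy => ->; rewrite adj_irr.
apply/and3P; split; first by apply/set0Pn; exists x; rewrite set21.
  exact: connected_set2.
apply/forall_inP=> z /set2P[]->.
  by rewrite setU1K ?connected_set1 // inE.
by rewrite setUC setU1K ?connected_set1 // inE eq_sym.
Qed.

Lemma nonseparableD1 S x : nonseparable S -> connected_set (S :\ x).
Proof.
case/and3P=> _ Sc /forall_inP/(_ x) SD; have [/SD//|xS] := boolP (x \in S).
have -> : S :\ x = S by apply/setP=> z; rewrite !inE; case: eqP => // ->; rewrite (negbTE xS).
exact: Sc.
Qed.

(** Whichever vertex is deleted, one of the two common vertices survives and joins the connected
    remainders of [S] and [T]. *)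
Lemma nonseparableU S T x y :
  x != y -> x \in S -> x \in T -> y \in S -> y \in T ->
  nonseparable S -> nonseparable T -> nonseparable (S :|: T).
Proof.
move=> nxy xS xT yS yT Sn Tn; apply/and3P; split.
- by apply/set0Pn; exists x; rewrite inE xS.
- case/and3P: Sn => _ Sc _; case/and3P: Tn => _ Tc _; exact: connected_setU xS xT Sc Tc.
apply/forall_inP=> z _; rewrite setDUl.
have [u [nuz uS uT]] : exists u, [/\ u != z, u \in S & u \in T].
  case: (eqVneq x z) => [<-|]; last by exists x.
  by exists y; rewrite eq_sym.
by apply: (@connected_setU _ _ u); rewrite ?inE ?nuz //; apply: nonseparableD1.
Qed.

Lemma connected_uniq_path S x y :
  connected_set S -> x \in S -> y \in S ->
  exists p, [/\ path (@adj G) x p, last x p = y, uniq (x :: p) &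
              {subset x :: p <= S}].
Proof.
move=> /connected_setP/(_ x y) Sc xS yS; have /connectP[q qP ->] := Sc xS yS.
case/shortenP: qP => p pP pu _ {Sc y yS q}; exists p; split=> //.
  by apply: sub_path pP => a b /and3P[].
elim: p x xS pP {pu} => [|a p IHp] x xS /=; first by move=> _ z /[!inE]/eqP->.
case/andP=> /and3P[_ aS _] pP z /[!inE]/predU1P[-> //|zp].
by apply: (IHp a); rewrite ?inE.
Qed.

Lemma block_nonseparable B : block B -> nonseparable B.
Proof. by case/maxsetP. Qed.

Lemma nonseparable_block S :
  nonseparable S -> exists2 B, block B & S \subset B.
Proof. by move=> Sn; have [B] := maxset_exists Sn; exists B. Qed.

Lemma block_max B S : block B -> nonseparable S -> B \subset S -> S = B.
Proof. by case/maxsetP=> _ Bm; apply: Bm. Qed.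

Lemma block_absorb B S x y :
  block B -> nonseparable S -> x != y ->
  x \in S -> x \in B -> y \in S -> y \in B -> S \subset B.
Proof.
move=> Bb Sn nxy xS xB yS yB; apply/setUidPr; apply: (block_max Bb).
  exact: nonseparableU nxy xS xB yS yB Sn (block_nonseparable Bb).
exact: subsetUr.
Qed.

(** Steps along edges not inside [B]. The gate of [x] will be the vertex of [B] that [x] reaches by
    such steps. *)
Definition outrel B : rel G := [rel a b | (a -- b) && ~~ ((a \in B) && (b \in B))].

Lemma outrel_sym B : connect_sym (outrel B).
Proof. by apply: sym_connect_sym => x y; rewrite /outrel /= adj_sym [X in ~~ X]andbC. Qed.

(* Otherwise an ear of B would close up to a cycle meeting B in two vertices. *)
Lemma outrel_inj B : block B -> {in B &, forall a b, connect (outrel B) a b -> a = b}.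
Proof.
move=> Bb a b' aB b'B /connectP[q0 qP Db']; apply/eqP/idPn => nab.
case/shortenP: qP Db' => q qP qu _ {q0} Db'.
have qB : has (mem B) q.
  apply/hasP; exists b' => //; rewrite Db' in nab *.
  by case: q {qP qu} Db' nab => [|? ?] /= _; rewrite ?eqxx // mem_last.
move: qP qu {Db' nab b'B b'}; case/split_find: qB => b p1 p2 bB p1B.
rewrite cat_path rcons_path => /andP[/andP[p1P lb] _].
rewrite -cat_cons cat_uniq => /andP[/=/andP[ap1 p1u] _].
have [p [pP pl pu pB]] : exists p, [/\ path (@adj G) b p, last b p = a, uniq (b :: p) &
              {subset b :: p <= B}].
  by apply: connected_uniq_path => //; case/and3P: (block_nonseparable Bb).
have nab : a != b by apply: contraNneq ap1 => ->; rewrite mem_rcons mem_head.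
have [p' Dp] : exists p', p = rcons p' a.
  case/lastP: p pl {pP pu pB} => [/= ba|p' z]; first by rewrite ba eqxx in nab.
  by rewrite last_rcons => ->; exists p'.
rewrite {}Dp {pl p} in pP pu pB.
(* Otherwise the ear would be a single edge inside [B], which [outrel] excludes. *)
have p1n : p1 != [::].
  by case: p1 lb {p1P p1B ap1 p1u} => //=; rewrite /outrel /= aB (bB : b \in B) andbF.
have cP : is_cycle (a :: p1 ++ b :: p').
  apply/andP; split.
    by case: (p1) p1n => //= ? ? _; rewrite size_cat /= addnS.
  apply/andP; split.
    rewrite /= rcons_cat cat_path /= pP andbT.
    rewrite (sub_path _ p1P) /=; last by move=> ? ? /andP[].
    by case/andP: lb.
  move: pu; rewrite -rcons_cons rcons_uniq => /andP[ab pu].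
  rewrite -cat_cons cat_uniq pu andbT cons_uniq.
  move: ap1 p1u; rewrite mem_rcons rcons_uniq inE negb_or => /andP[_ ->] /andP[_ ->].
  apply/hasPn => z zp; rewrite inE negb_or; apply/andP; split.
    by apply: contraNneq ab => <-.
  apply/negP => zp1; move/hasPn/(_ z zp1)/negP: p1B; apply; apply: pB.
  by rewrite -rcons_cons mem_rcons inE zp orbT.
have /subsetP cB : [set x in a :: p1 ++ b :: p'] \subset B.
  apply: (block_absorb Bb (cycle_nonseparable cP) nab) => //.
    by rewrite !inE eqxx.
  by rewrite !inE mem_cat mem_head !orbT.
case: p1 p1n p1B cB {p1P lb ap1 p1u cP} => //= z p1 _ /norP[/negP zB _] /(_ z).
by rewrite !inE eqxx orbT => /(_ isT).
Qed.

End Nonseparable.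

(** * Gates, and cycles inside blocks *)

(* pi B x is the vertex at which every path from x enters B. *)
Record gated (G : sgraph) (BB : {set {set G}}) (pi : {set G} -> G -> G) : Prop := Gated {
  gated_conn : connected_graph G;
  gated_block : forall B, B \in BB -> edge_block B \/ cycle_block B;
  gated_edge : forall x y, x -- y -> exists2 B, B \in BB & (x \in B) && (y \in B);
  gated_in : forall B x, B \in BB -> pi B x \in B;
  gated_id : forall B x, B \in BB -> x \in B -> pi B x = x;
  gated_out : forall B x y, B \in BB -> x -- y -> ~~ ((x \in B) && (y \in B)) ->
    pi B x = pi B y }.

Lemma edge_or_cycle_nonseparable (G : sgraph) (B : {set G}) :
  edge_block B \/ cycle_block B -> nonseparable B.
Proof.
case=> [[x [y [xy ->]]]|[c [cc -> _]]]; first exact: edge_nonseparable.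
exact: cycle_nonseparable.
Qed.

Lemma cactus_gated (G : sgraph) :
  connected_graph G -> cactus G -> exists pi, gated [set B : {set G} | block B] pi.
Proof.
(* For a block the default [x] is never taken: [G] is connected, and a path from [x] to [B], stopped
   on entering [B], provides a vertex to pick. *)
move=> Gc Gk; pose pi (B : {set G}) x : G := odflt x [pick a in B | connect (outrel B) x a].
have piP B x : block B -> (pi B x \in B) && connect (outrel B) x (pi B x).
  move=> Bb; have /and3P[/set0Pn[b bB] _ _] := block_nonseparable Bb.
  have [p [+ pl _ _]] := connected_uniq_path Gc (in_setT x) (in_setT b).
  rewrite -pl {pl} in bB; rewrite /pi; case: pickP => [a //|/= N pP].
  have [a aB xa] : exists2 a, a \in B & connect (outrel B) x a.
    elim: p x pP bB {N} => [|y p IHp] x /=; first by exists x.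
    case/andP=> xy pP /(IHp _ pP)[a aB ya].
    have [xB|xB] := boolP (x \in B); first by exists x.
    exists a => //; apply: connect_trans ya; apply: connect1.
    by rewrite /outrel /= xy (negbTE xB).
  by have := N a; rewrite aB xa.
have piE B x a : block B -> a \in B -> connect (outrel B) x a -> pi B x = a.
  move=> Bb aB xa; have /andP[pB xp] := piP B x Bb.
  by apply: (outrel_inj Bb) => //; apply: connect_trans xa; rewrite outrel_sym.
exists pi; split=> //.
- by move=> B; rewrite inE => /Gk.
- move=> x y xy; have [B Bb /subsetP xyB] := nonseparable_block (edge_nonseparable xy).
  by exists B; rewrite ?inE // !xyB ?set21 ?set22.
- by move=> B x; rewrite inE => /(piP _ x)/andP[].
- by move=> B x; rewrite inE => Bb xB; apply: piE.
move=> B x y; rewrite inE => Bb xy nB; have /andP[pB yp] := piP B y Bb.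
by apply: piE => //; apply: connect_trans yp; apply: connect1; rewrite /outrel /= xy.
Qed.

Lemma card_cycle_set (G : sgraph) (c : seq G) : is_cycle c -> #|[set x in c]| = size c.
Proof. by case/and3P=> _ _ cu; rewrite cardsE; apply/card_uniqP. Qed.

Lemma edge_neq (G : sgraph) (x y : G) : x -- y -> x != y.
Proof. by apply: contraTneq => ->; rewrite adj_irr. Qed.

Lemma set2_inj (T : finType) (x y z w : T) :
  [set x; y] = [set z; w] -> (x = z /\ y = w) \/ (x = w /\ y = z).
Proof.
move=> E; have : x \in [set z; w] by rewrite -E set21.
have : y \in [set z; w] by rewrite -E set22.
have : z \in [set x; y] by rewrite E set21.
have : w \in [set x; y] by rewrite E set22.
by do 4!case/set2P=> ?; subst; auto.
Qed.

Section Cycle.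
Variables (G : sgraph) (c : seq G).
Hypothesis cP : is_cycle c.

Lemma cycle_uniq : uniq c.
Proof. by case/and3P: cP. Qed.

Lemma cycle_size : 2 < size c.
Proof. by case/andP: cP. Qed.

Lemma cycle_adj_next x : x \in c -> x -- next c x.
Proof. by case/and3P: cP => _ cc _; apply: next_cycle. Qed.

Lemma next_next_neq x : x \in c -> next c (next c x) != x.
Proof.
move=> xc; have [i p Dp] := rot_to xc.
have cu := cycle_uniq; have := cycle_size; have := rot_uniq i c.
rewrite -!(next_rot i cu) -(size_rot i c) {}Dp cu.
case: p => [|a [|b p]] //= /andP[+ /andP[+ _]] _.
rewrite !inE !negb_or eqxx => /and3P[xa xb _] /andP[ab _].
by rewrite [a == x]eq_sym (negbTE xa) eqxx eq_sym.
Qed.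

Lemma next_neq_prev x : x \in c -> next c x != prev c x.
Proof.
move=> xc; apply: contraTneq (next_next_neq xc) => ->.
by rewrite next_prev ?cycle_uniq // eqxx.
Qed.

Lemma mem_cycle_edges x y : x \in c ->
  ([set x; y] \in cycle_edges c) = (y == next c x) || (y == prev c x).
Proof.
have cu := cycle_uniq; move=> xc; apply/imsetP/orP => [[z zc /set2_inj[[-> ->]|[-> ->]]]|].
- by left.
- by right; rewrite prev_next.
case=> /eqP->; first by exists x.
by exists (prev c x); rewrite ?mem_prev // next_prev // setUC.
Qed.
End Cycle.

Section CycleBlock.
Variables (G : sgraph) (B : {set G}) (c : seq G).
Hypotheses (cP : is_cycle c) (Bc : B = [set x in c]).
Hypothesis Bind : forall x y, x \in B -> y \in B -> x -- y -> [set x; y] \in cycle_edges c.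

Lemma cycle_block_nbr x : x \in B -> [set y in B | x -- y] = [set next c x; prev c x].
Proof.
move=> xB; have xc : x \in c by rewrite Bc inE in xB.
apply/setP=> y; rewrite !inE; apply/andP/orP => [[yB xy]|].
  by have := Bind xB yB xy; rewrite mem_cycle_edges // => /orP.
case=> /eqP->; rewrite Bc inE ?mem_next ?mem_prev; split=> //.
  exact: cycle_adj_next.
by rewrite adj_sym -{2}(next_prev (cycle_uniq cP) x) cycle_adj_next ?mem_prev.
Qed.

Lemma cycle_block_connected : connected_set B.
Proof. by rewrite Bc; case/and3P: (cycle_nonseparable cP). Qed.

(** Each vertex of [B] has just two neighbours in [B], and a cycle inside [B] uses two distinct ones
    at each of its vertices. So [c'] is closed under adjacency in [B], and covers [B] by
    connectedness. The right-hand side names no sequence, so all such cycles have the same edges. *)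
Lemma cycle_block_uniq c' : is_cycle c' -> {subset c' <= B} ->
  cycle_edges c' = [set [set x; y] | x in B, y in B & x -- y].
Proof.
move=> c'P c'B.
have nbr x y : x \in c' -> y \in B -> x -- y -> (y == next c' x) || (y == prev c' x).
  move=> xc' yB xy; have xB := c'B x xc'.
  have E : [set next c' x; prev c' x] = [set y in B | x -- y].
    apply/eqP; rewrite eqEcard (cycle_block_nbr xB) !cards2 !next_neq_prev //.
      rewrite leqnn andbT -cycle_block_nbr //.
      apply/subsetP=> z /set2P[]->; rewrite inE c'B ?mem_next ?mem_prev //=.
        exact: cycle_adj_next.
      by rewrite adj_sym -{2}(next_prev (cycle_uniq c'P) x) cycle_adj_next ?mem_prev.
    by rewrite Bc inE in xB.
  have : y \in [set next c' x; prev c' x] by rewrite E inE yB xy.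
  by case/set2P=> ->; rewrite eqxx ?orbT.
have Bc' x : x \in B -> x \in c'.
  move=> xB.
  have [x0 x0c'] : exists x, x \in c'.
    by case: (c') (cycle_size c'P) => // z p _; exists z; rewrite mem_head.
  have [p [+ <- _ +]] := connected_uniq_path cycle_block_connected (c'B _ x0c') xB.
  elim: p x0 x0c' => //= z p IHp x0 x0c' /andP[x0z /IHp pP] sB.
  apply: pP; last by move=> w wp; apply: sB; rewrite inE wp orbT.
  have zB : z \in B by apply: sB; rewrite !inE eqxx orbT.
  by case/orP: (nbr x0 z x0c' zB x0z) => /eqP->; rewrite ?mem_next ?mem_prev.
apply/setP=> e; apply/imsetP/imset2P => [[x xc' ->]|[x y xB]].
  exists x (next c' x) => //; rewrite ?c'B // inE c'B ?mem_next //=.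
  exact: cycle_adj_next.
rewrite inE => /andP[yB xy] ->.
by apply/imsetP; rewrite -/(cycle_edges c') mem_cycle_edges ?Bc' // nbr ?Bc'.
Qed.
End CycleBlock.

(** * Block structure deduced from gates *)

Section Gated.
Variables (G : sgraph) (BB : {set {set G}}) (pi : {set G} -> G -> G).
Hypothesis Gg : gated BB pi.
Implicit Types (B S : {set G}) (x y u v : G).

Lemma gated_nonseparable B : B \in BB -> nonseparable B.
Proof. by move=> BBB; apply: edge_or_cycle_nonseparable; apply: (gated_block Gg). Qed.

Lemma gated_card_gt1 B : B \in BB -> 1 < #|B|.
Proof.
case/(gated_block Gg) => [[x [y [/edge_neq nxy ->]]]|[c [cP -> _]]].
  by rewrite cards2 nxy.
by rewrite card_cycle_set // ltnW ?cycle_size.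
Qed.

Lemma gated_inner_deg B x : B \in BB -> x \in B ->
  #|[set y in B | x -- y]| = (if #|B| == 2 then 1 else 2).
Proof.
case/(gated_block Gg) => [[a [b [ab ->]]]|[c [cP Bc Bind]]] xB.
  rewrite cards2 (edge_neq ab) /=.
  case/set2P: xB => ->; [rewrite -(cards1 b) | rewrite -(cards1 a)].
  - apply: eq_card => z; rewrite !inE; case: (eqVneq z a) => [->|nza] /=.
      by rewrite adj_irr (negbTE (edge_neq ab)).
    by case: eqP => // ->.
  - apply: eq_card => z; rewrite !inE; case: (eqVneq z b) => [->|nza] /=.
      by rewrite orbT adj_irr eq_sym (negbTE (edge_neq ab)).
    by rewrite orbF; case: eqP => // ->; rewrite adj_sym.
have xc : x \in c by rewrite Bc inE in xB.
rewrite (cycle_block_nbr cP Bc Bind xB) cards2 next_neq_prev //.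
by rewrite Bc card_cycle_set // gtn_eqF // cycle_size.
Qed.

(** Gates change only along edges inside [B], whose ends are their own gates; on a path avoiding [x]
    neither end is [x]. *)
Lemma gate_path B x y p : B \in BB -> x \in B ->
  path (@adj G) y p -> x \notin y :: p -> (pi B y == x) = (pi B (last y p) == x).
Proof.
move=> BBB xB; elim: p y => //= z p IHp y /andP[yz pP].
rewrite in_cons negb_or => /andP[nxy xp]; rewrite -(IHp z pP xp).
have [/andP[yB zB]|/(gated_out Gg BBB yz)-> //] := boolP ((y \in B) && (z \in B)).
rewrite !(gated_id Gg) // eq_sym (negbTE nxy) eq_sym.
by move: xp; rewrite inE negb_or => /andP[/negbTE->].
Qed.

(** Deleting the gate of a vertex [z] of [S] outside [B] would separate [z] from every other vertex
    of [B], and one of [x], [y] is such a vertex. Maximality of the members of [BB] follows from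
    this. *)
Lemma gated_absorb S B x y : nonseparable S -> B \in BB -> x != y ->
  x \in S -> x \in B -> y \in S -> y \in B -> S \subset B.
Proof.
move=> Sn BBB nxy xS xB yS yB; apply/subsetP=> z zS; apply/idPn=> zB.
have [u [nug uS uB]] : exists u, [/\ u != pi B z, u \in S & u \in B].
  case: (eqVneq x (pi B z)) => [<-|]; last by exists x.
  by exists y; rewrite eq_sym.
have gB : pi B z \in B by apply: (gated_in Gg).
have nzg : z != pi B z by apply: contraNneq zB => ->.
have zSg : z \in S :\ pi B z by rewrite !inE nzg.
have uSg : u \in S :\ pi B z by rewrite !inE nug.
have [p [pP pl _ pS]] := connected_uniq_path (nonseparableD1 (pi B z) Sn) zSg uSg.
have := gate_path BBB gB pP; rewrite pl (gated_id Gg BBB uB) eqxx (negbTE nug).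
suff gN : pi B z \notin z :: p by move/(_ gN).
by apply/negP => /pS; rewrite !inE eqxx.
Qed.

Lemma gated_eq B B' x y : B \in BB -> B' \in BB -> x != y ->
  x \in B -> x \in B' -> y \in B -> y \in B' -> B = B'.
Proof.
move=> BBB BBB' nxy xB xB' yB yB'; apply/eqP; rewrite eqEsubset.
apply/andP; split.
  exact: (gated_absorb (gated_nonseparable BBB) BBB' nxy).
exact: (gated_absorb (gated_nonseparable BBB') BBB nxy).
Qed.

(** Distinct members share at most one vertex, so no edge inside [B'] is inside [B], and the gate is
    constant along a path in [B']. *)
Lemma gate_const B B' x y : B \in BB -> B' \in BB -> B != B' ->
  x \in B' -> y \in B' -> pi B x = pi B y.
Proof.
move=> BBB BBB' nBB' xB' yB'.
have /and3P[_ B'c _] := gated_nonseparable BBB'.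
have [p [+ <- _ +]] := connected_uniq_path B'c xB' yB'.
elim: p x {xB'} => //= z p IHp x /andP[xz pP] sB'.
have xB' : x \in B' by apply: sB'; rewrite mem_head.
have zB' : z \in B' by apply: sB'; rewrite !inE eqxx orbT.
rewrite -(IHp z pP) => [|w wp]; last by apply: sB'; rewrite inE wp orbT.
apply: (gated_out Gg) => //; apply: contra nBB' => /andP[xB zB].
by apply/eqP; apply: (gated_eq _ _ (edge_neq xz)).
Qed.

Lemma gated_cover S : nonseparable S -> 1 < #|S| -> exists2 B, B \in BB & S \subset B.
Proof.
move=> Sn /card_gt1P[x [y [xS yS nxy]]].
have /and3P[_ Sc _] := Sn.
have [[|z p] [pP pl _ pS]] := connected_uniq_path Sc xS yS.
  by rewrite -pl /= eqxx in nxy.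
have /= /andP[xz _] := pP; have [B BBB /andP[xB zB]] := gated_edge Gg xz.
exists B => //; apply: (gated_absorb Sn BBB (edge_neq xz)) => //.
by apply: pS; rewrite !inE eqxx orbT.
Qed.

(** The one-vertex graph is the exception: its block is a singleton, while members of [BB] have at
    least two vertices. In any larger connected graph a singleton lies in an edge and is not
    maximal. *)
Lemma gated_blockE B : 1 < #|G| -> block B = (B \in BB).
Proof.
move=> G2; apply/idP/idP => [Bb|BBB].
  have Bn := block_nonseparable Bb.
  have [B2|B1] := ltnP 1 #|B|.
    have [B' BBB' sBB'] := gated_cover Bn B2.
    by rewrite -(block_max Bb (gated_nonseparable BBB') sBB').
  have /set0Pn[x xB] : B != set0 by case/and3P: Bn.
  have Bx : B = [set x].
    by apply/esym/eqP; rewrite eqEcard sub1set xB cards1.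
  have [y nyx] : exists y, y != x.
    have : 0 < #|[set~ x]| by rewrite cardsC1; lia.
    by case/card_gt0P => y; rewrite !inE; exists y.
  have [[|z p] [pP pl _ _]] := connected_uniq_path (gated_conn Gg) (in_setT x) (in_setT y).
    by rewrite -pl /= eqxx in nyx.
  have /= /andP[xz _] := pP.
  have := block_max Bb (edge_nonseparable xz).
  rewrite Bx sub1set set21 => /(_ isT)/setP/(_ z); rewrite !inE eqxx orbT.
  by move=> /esym/eqP zx; move: (edge_neq xz); rewrite zx eqxx.
apply/maxsetP; split=> [|S Sn sBS]; first exact: gated_nonseparable.
have [x [y [xB yB nxy]]] := card_gt1P (gated_card_gt1 BBB).
apply/eqP; rewrite eqEsubset sBS andbT.
by apply: (gated_absorb Sn BBB nxy) => //; apply: (subsetP sBS).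
Qed.

Lemma gated_cactus : 1 < #|G| -> cactus G.
Proof. by move=> G2 S; rewrite gated_blockE // => /(gated_block Gg). Qed.

(** A cycle is nonseparable, hence lies in one member of [BB], which then contains no other cycle.
    The edge set [E B] determines [B] as its cover, so distinct members have distinct cycles. *)
Lemma gated_cycles : #|cycles G| = #|[set B in BB | 2 < #|B|]|.
Proof.
pose E B := [set [set x; y] | x in B, y in B & x -- y].
have covE B : B \in BB -> cover (E B) = B.
  move=> BBB; apply/setP=> x; apply/bigcupP/idP => [[e /imset2P[y z yB]]|xB].
    by rewrite inE => /andP[zB _] -> /set2P[]->.
  have : 0 < #|[set y in B | x -- y]| by rewrite gated_inner_deg //; case: ifP.
  case/card_gt0P=> y; rewrite inE => /andP[yB xy].
  by exists [set x; y]; rewrite ?set21 //; apply/imset2P; exists x y; rewrite ?inE ?yB.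
rewrite -(card_in_imset (f := E)); last first.
  by move=> B B'; rewrite !inE => /andP[+ _] /andP[+ _] => /covE {2}<- /covE {2}<- ->.
apply: eq_card => F; rewrite inE; apply/existsP/imsetP.
  case=> k /existsP[c /andP[cP /eqP->]].
  have [|B BBB cB] := gated_cover (cycle_nonseparable cP).
    by rewrite card_cycle_set // ltnW ?cycle_size.
  have B3 : 2 < #|B|.
    by apply: leq_trans (subset_leq_card cB); rewrite card_cycle_set // cycle_size.
  exists B; rewrite ?inE ?BBB //.
  have [[x [y [_ BE]]]|[c0 [c0P Bc0 Bind]]] := gated_block Gg BBB.
    by move: B3; rewrite BE cards2; case: (x != y).
  apply: (cycle_block_uniq c0P Bc0 Bind cP) => x xc.
  by apply: (subsetP cB); rewrite inE.
case=> B; rewrite inE => /andP[BBB B3] ->.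
have [[x [y [_ BE]]]|[c0 [c0P Bc0 Bind]]] := gated_block Gg BBB.
  by move: B3; rewrite BE cards2; case: (x != y).
have kP : size c0 < #|G|.+1.
  by rewrite ltnS -(card_cycle_set c0P) max_card.
exists (Ordinal kP); apply/existsP; exists (in_tuple c0); rewrite c0P /=.
apply/eqP/esym/(cycle_block_uniq c0P Bc0 Bind) => //.
by move=> x; rewrite Bc0 inE.
Qed.

(* The unique such block contains the first edge of every path from x to u. *)
Lemma card_block_toward u x :
  #|[set B in BB | (x \in B) && (pi B u != x)]| = (x != u).
Proof.
case: (eqVneq x u) => [->|nxu].
  apply/eqP; rewrite cards_eq0; apply/eqP/setP=> B; rewrite !inE.
  by apply/and3P=> -[BBB uB]; rewrite (gated_id Gg) // eqxx.
have [[|z p] [pP pl pu _]] := connected_uniq_path (gated_conn Gg) (in_setT x) (in_setT u).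
  by rewrite -pl /= eqxx in nxu.
have /= /andP[xz zpP] := pP; have /= pl' := pl.
have xzp : x \notin z :: p by case/andP: pu.
have [B BBB /andP[xB zB]] := gated_edge Gg xz.
rewrite -(cards1 B); apply: eq_card => B'; rewrite !inE.
apply/idP/eqP => [/and3P[BBB' xB' nux]|->]; last first.
  rewrite BBB xB /= -pl' -(gate_path BBB xB zpP xzp) (gated_id Gg) //.
  by rewrite eq_sym (edge_neq xz).
apply/eqP/idPn => nBB'; case/negP: nux.
rewrite -pl' -(gate_path BBB' xB' zpP xzp) -(gated_out Gg BBB' xz).
  by rewrite (gated_id Gg).
apply: contra nBB' => /andP[_ zB'].
by apply/eqP; apply: (gated_eq _ _ (edge_neq xz)).
Qed.

End Gated.

(** * Vertices and cycles beyond a block *)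

Section Fibers.
Variables (G : sgraph) (BB : {set {set G}}) (pi : {set G} -> G -> G).
Hypothesis Gg : gated BB pi.
Implicit Types (B S : {set G}) (x y u v a : G).

Definition fiber B a := [set x | pi B x == a].
(* hang and hang_cycles are the x_a and c_a of the header. *)
Definition hang B a := #|fiber B a|.-1.
Definition hang_cycles B a :=
  #|[set B' in BB | [&& B' != B, B' \subset fiber B a & 2 < #|B'|]]|.
Definition inner_deg B := if #|B| == 2 then 1 else 2.

Lemma fiber_root B a : B \in BB -> a \in B -> a \in fiber B a.
Proof. by move=> BBB aB; rewrite inE (gated_id Gg). Qed.

Lemma card_fiber B a : B \in BB -> a \in B -> #|fiber B a| = (hang B a).+1.
Proof.
move=> BBB aB; rewrite /hang prednK //.
by apply/card_gt0P; exists a; apply: fiber_root.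
Qed.

Lemma fiberI B a : B \in BB -> a \in B -> B :&: fiber B a = [set a].
Proof.
move=> BBB aB; apply/setP=> x; rewrite !inE; case: (boolP (x \in B)) => [xB|xB] /=.
  by rewrite (gated_id Gg).
by apply/esym/negbTE; apply: contraNneq xB => ->.
Qed.

Lemma block_fiber B B' x : B \in BB -> B' \in BB -> B' != B -> x \in B' ->
  B' \subset fiber B (pi B x).
Proof.
move=> BBB BBB' nBB' xB'; apply/subsetP=> y yB'; rewrite inE; apply/eqP.
by apply: (gate_const Gg BBB BBB') => //; rewrite eq_sym.
Qed.

Lemma block_fiberI B B' a : B \in BB -> B' \in BB -> B' != B ->
  B' :&: fiber B a = if B' \subset fiber B a then B' else set0.
Proof.
move=> BBB BBB' nBB'; case: ifPn => [|sB']; first by move/setIidPl.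
apply/setP=> x; rewrite !inE; apply/andP=> -[xB' /eqP Dx].
by case/negP: sB'; rewrite -Dx; apply: block_fiber.
Qed.

(** Double counting: each [x != u] is charged to the one block through which it proceeds to [u]. The
    whole vertex set as [S] gives [sum_block_size], a fiber gives [hang_sum]. *)
Lemma sum_toward u (S : {set G}) :
  \sum_(x in S) (x != u) = \sum_(B in BB) #|(B :\ pi B u) :&: S|.
Proof.
under eq_bigr => x _ do rewrite -(card_block_toward Gg u x) -sum1_card.
rewrite (exchange_big_dep [in BB]) /=; last first.
  by move=> x B _; rewrite inE => /andP[].
apply: eq_bigr => B BBB; rewrite -sum1_card; apply: eq_bigl => x.
by rewrite !inE BBB eq_sym /= andbC [(x \in B) && _]andbC.
Qed.

Lemma sum_block_size : 0 < #|G| -> \sum_(B in BB) #|B|.-1 = #|G|.-1.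
Proof.
case/card_gt0P=> u _; have := sum_toward u setT.
under eq_bigl do rewrite inE.
rewrite (bigD1 u) //= eqxx add0n.
have -> : \sum_(i | i != u) (i != u) = #|G|.-1.
  rewrite -(cardC1 u) -sum1_card; apply: eq_big => [x|x ->//]; by rewrite !inE.
move=> ->; apply: eq_bigr => B BBB; rewrite setIT.
by rewrite (cardsD1 (pi B u) B) (gated_in Gg).
Qed.

Lemma hang_sum B a : B \in BB -> a \in B ->
  hang B a = \sum_(B' in BB | (B' != B) && (B' \subset fiber B a)) #|B'|.-1.
Proof.
move=> BBB aB; have := sum_toward a (fiber B a).
have -> : \sum_(x in fiber B a) (x != a) = hang B a.
  rewrite (bigD1 a) ?fiber_root //= eqxx add0n /hang (cardsD1 a) fiber_root //=.
  by rewrite -sum1_card; apply: eq_big => [x|x /andP[_ ->]//]; rewrite !inE andbC.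
move=> ->; rewrite (bigD1 B) //= setIDAC fiberI // (gated_id Gg) // setDv cards0 add0n.
rewrite [RHS]big_mkcondr [LHS]big_mkcondr /=; apply: eq_bigr => B' BBB'.
case: (boolP (B' != B)) => //= nBB'; rewrite setIDAC block_fiberI //.
case: ifP => _; last by rewrite set0D cards0.
by rewrite [in RHS](cardsD1 (pi B' a)) (gated_in Gg).
Qed.

Lemma deg_sum x : deg x = \sum_(B in BB | x \in B) inner_deg B.
Proof.
rewrite /deg -sum1_card.
under [RHS]eq_bigr => B /andP[BBB xB]
  do rewrite /inner_deg -(gated_inner_deg Gg BBB xB) -sum1_card.
rewrite (exchange_big_dep [in [set v | x -- v]]) /=; last first.
  by move=> B y _; rewrite !inE => /andP[].
apply: eq_bigr => y; rewrite inE => xy.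
have [B BBB /andP[xB yB]] := gated_edge Gg xy.
rewrite sum1_card -(cards1 B); apply: eq_card => B'; rewrite [RHS]unfold_in !inE xy andbT.
apply/eqP/andP => [->|[/andP[BBB' xB'] yB']]; first by rewrite BBB xB yB.
by apply: (gated_eq Gg _ _ (edge_neq xy)).
Qed.

Lemma sum_deg (S : {set G}) :
  \sum_(x in S) deg x = \sum_(B in BB) inner_deg B * #|B :&: S|.
Proof.
under eq_bigr do rewrite deg_sum.
rewrite (exchange_big_dep [in BB]) /=; last by move=> x B _ /andP[].
apply: eq_bigr => B BBB; rewrite -sum1_card mulnC big_distrl /=.
by under [RHS]eq_bigr do rewrite mul1n; apply: eq_bigl => x; rewrite !inE BBB andbC.
Qed.

(** Both sides are twice the number of edges of the block: a spanning tree, and one closing edge if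
    it is a cycle. *)
Lemma inner_deg_mul B : B \in BB ->
  inner_deg B * #|B| = 2 * #|B|.-1 + 2 * (2 < #|B|).
Proof.
by move=> /(gated_card_gt1 Gg); rewrite /inner_deg; case: eqP => [->//|]; lia.
Qed.

Lemma sum_deg_total : 0 < #|G| ->
  \sum_(x : G) deg x = 2 * #|G|.-1 + 2 * #|cycles G|.
Proof.
move=> G0; have := sum_deg setT; under eq_bigl do rewrite inE.
move=> ->; under eq_bigr => B BBB do rewrite setIT inner_deg_mul //.
rewrite big_split /= -!big_distrr /= sum_block_size // (gated_cycles Gg).
congr (_ + 2 * _); rewrite -big_mkcondr /= -sum1_card.
by rewrite [RHS](eq_bigl (fun B => (B \in BB) && (2 < #|B|))) => [|B]; rewrite ?inE //;
   rewrite big_mkcondr; apply: eq_bigr => B _; case: ltnP.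
Qed.

Lemma hang_cyclesE B a : hang_cycles B a =
  \sum_(B' in BB | (B' != B) && (B' \subset fiber B a)) (2 < #|B'|).
Proof.
rewrite /hang_cycles -sum1_card big_mkcond [RHS]big_mkcond; apply: eq_bigr => B' _.
by rewrite !inE; do 3!case: (_ \in _) || case: (_ != _) || case: (_ \subset _) => //=; case: (_ < _).
Qed.

(** Handshake inside a fiber: [B] contributes only the inner degree of [a], and every block beyond
    [a] twice its number of edges. The closing edges of cycles are what brings [c_a] into the
    excess. *)
Lemma sum_deg_fiber B a : B \in BB -> a \in B ->
  \sum_(x in fiber B a) deg x = inner_deg B + 2 * hang B a + 2 * hang_cycles B a.
Proof.
move=> BBB aB; rewrite sum_deg (bigD1 B) //= fiberI // cards1 muln1 -addnA.
congr (_ + _); rewrite hang_sum // hang_cyclesE !big_distrr -big_split /=.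
rewrite [RHS](eq_bigl (fun B' => ((B' \in BB) && (B' != B)) && (B' \subset fiber B a))); last first.
  by move=> B' /=; rewrite andbA.
rewrite [RHS]big_mkcondr; apply: eq_bigr => B' /andP[BBB' nBB'].
rewrite block_fiberI //; case: ifP => _; last by rewrite cards0 muln0.
by rewrite inner_deg_mul.
Qed.

Lemma sum_hang B : B \in BB -> \sum_(a in B) hang B a + #|B| = #|G|.
Proof.
move=> BBB; rewrite -sum1_card -big_split /=.
rewrite [RHS](eq_card (B := [set: G])) => [|x]; last by rewrite !inE.
rewrite -sum1_card [RHS](partition_big (pi B) [in B]) /=; last by move=> x _; apply: (gated_in Gg).
apply: eq_bigr => a aB; rewrite addn1 -card_fiber // -sum1_card.
by apply: eq_bigl => x; rewrite !inE.
Qed.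

Lemma sum_hang_cycles B : B \in BB ->
  \sum_(a in B) hang_cycles B a + (2 < #|B|) = #|cycles G|.
Proof.
move=> BBB; under eq_bigr do rewrite hang_cyclesE.
have -> : #|cycles G| = \sum_(B' in BB) (2 < #|B'|).
  rewrite (gated_cycles Gg) -sum1_card big_mkcond [RHS]big_mkcond.
  by apply: eq_bigr => B' _; rewrite inE; case: (_ \in _); case: (_ < _).
rewrite [RHS](bigD1 B) //= addnC; congr (_ + _).
rewrite (exchange_big_dep (fun B' => (B' \in BB) && (B' != B))) /=; last first.
  by move=> a B' _ /and3P[-> ->].
apply: eq_bigr => B' /andP[BBB' nBB'].
have /card_gt0P[x xB'] : 0 < #|B'| by apply: ltnW; apply: (gated_card_gt1 Gg).
rewrite (bigD1 (pi B x)) /=; last first.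
  by rewrite BBB' nBB' block_fiber // (gated_in Gg).
rewrite big1 ?addn0 // => a /andP[/andP[aB /and3P[_ _ /subsetP sB']]].
by have := sB' x xB'; rewrite inE => /eqP->; rewrite eqxx.
Qed.

(** Every cycle beyond [a] brings at least two vertices of its own. *)
Lemma hang_cycles_le B a : B \in BB -> a \in B -> 2 * hang_cycles B a <= hang B a.
Proof.
move=> BBB aB; rewrite hang_sum // hang_cyclesE big_distrr /=.
by apply: leq_sum => B' /andP[/(gated_card_gt1 Gg) + _]; case: ltnP; lia.
Qed.

End Fibers.

(** * Resistance in an edge and in a cycle *)

Local Open Scope ring_scope.

Section Kernel.
Variables (R : realFieldType) (G : sgraph).
Implicit Types (rho : G -> G -> R) (a u v x y : G).

(* p x = (rho v x - rho u x) / 2 satisfies Kirchhoff's equations, K cancelling out. *)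
Lemma resistance_kernel rho (K : G -> R) u v :
  connected_graph G -> (forall x y, rho x y = rho y x) -> (forall x, rho x x = 0) ->
  (forall a x, \sum_(y | x -- y) (rho a x - rho a y) = K x - 2 * (x == a)%:R) ->
  resistance R u v = rho u v.
Proof.
move=> Gc rhoC rho0 rhoL; pose p x := (rho v x - rho u x) / 2.
rewrite (resistance_unique (p := p)) //; first by rewrite /p !rho0 (rhoC v u); field.
move=> x; transitivity (\sum_(y | x -- y)
    ((rho v x - rho v y) - (rho u x - rho u y)) / 2).
  by apply: eq_bigr => y _; rewrite /p; field.
by rewrite -mulr_suml sumrB !rhoL; field.
Qed.

(** Over ordered pairs the weight involves [u] alone, which lets the sum factor into degrees over
    one fiber and the size of another. *)
Lemma DR_ordered rho : (forall u v, resistance R u v = rho u v) ->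
  (forall x y, rho x y = rho y x) -> (forall x, rho x x = 0) ->
  DR R G = \sum_(u : G) \sum_(v : G) (deg u)%:R * rho u v.
Proof.
move=> rhoE rhoC rho0; rewrite /DR.
pose F u v := (deg u)%:R * rho u v.
transitivity (\sum_u (\sum_(v | (enum_rank u < enum_rank v)%N) F u v +
                      \sum_(v | (enum_rank v < enum_rank u)%N) F u v)).
  rewrite big_split /= [X in _ + X](exchange_big_dep xpredT) //= -big_split /=.
  apply: eq_bigr => u _; rewrite -big_split /=; apply: eq_bigr => v _.
  by rewrite rhoE /F (rhoC v u) natrD mulrDl.
apply: eq_bigr => u _; rewrite [RHS](bigID (fun v => (enum_rank u < enum_rank v)%N)) /=.
congr (_ + _); rewrite big_mkcond [RHS]big_mkcond /=; apply: eq_bigr => v _.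
case: (ltngtP (enum_rank u) (enum_rank v)) => //= /val_inj/enum_rank_inj->.
by rewrite rho0 mulr0.
Qed.

End Kernel.

Section CycleKernel.
Variable R : realFieldType.

(** Arcs of [d] and [k - d] unit resistors in parallel. *)
Definition arc_res (k d : nat) : R := d%:R * (k%:R - d%:R) / k%:R.

Lemma arc_resC k d : (0 < k)%N -> (d <= k)%N -> arc_res k (k - d) = arc_res k d.
Proof.
move=> k0 dk; rewrite /arc_res natrB //; have : k%:R != 0 :> R by rewrite pnatr_eq0; lia.
by move=> nz; field.
Qed.

Lemma arc_res_ge k d : (2 < k)%N -> (0 < d < k)%N -> 2 / 3 <= arc_res k d.
Proof.
move=> k2 /andP[d0 dk]; rewrite /arc_res.
have kR : 3 <= k%:R :> R by rewrite ler_nat.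
have dR : 1 <= d%:R :> R by rewrite ler1n.
have dkR : d%:R + 1 <= k%:R :> R by rewrite natr1 ler_nat.
rewrite ler_pdivlMr; last by lra.
nra.
Qed.

Lemma sum_arc_res k m : (0 < k)%N ->
  \sum_(0 <= d < m) arc_res k d = m%:R * (m%:R - 1) * (3 * k%:R - 2 * m%:R + 1) / (6 * k%:R).
Proof.
move=> k0; have nz : k%:R != 0 :> R by rewrite pnatr_eq0; lia.
elim: m => [|m IHm]; first by rewrite big_nil !mul0r.
by rewrite big_nat_recr //= IHm /arc_res -natr1; field.
Qed.

Lemma row_arc_res k i : (i < k)%N ->
  \sum_(0 <= j < k) arc_res k ((i - j) + (j - i))%N = (k%:R ^+ 2 - 1) / 6.
Proof.
move=> ik; have nz : k%:R != 0 :> R by rewrite pnatr_eq0; lia.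
rewrite (big_cat_nat _ (n := i)) //=; last exact: ltnW.
(* Read downwards from [i], these are the distances [1, ..., i]; the vanishing term for [d = 0] is
   prefixed. *)
have -> : \sum_(0 <= j < i) arc_res k ((i - j) + (j - i))%N = \sum_(0 <= d < i.+1) arc_res k d.
  rewrite [RHS]big_nat_recl // /arc_res mul0r mul0r add0r.
  rewrite big_nat_rev /= big_nat [RHS]big_nat; apply: eq_bigr => j /andP[_ ji].
  by have -> : ((i - (0 + i - j.+1)) + ((0 + i - j.+1) - i) = j.+1)%N by lia.
have -> : \sum_(i <= j < k) arc_res k ((i - j) + (j - i))%N = \sum_(0 <= d < k - i) arc_res k d.
  rewrite -{1}[i]add0n big_addn; apply: eq_bigr => j _.
  by have -> : ((i - (j + i)) + (j + i - i) = j)%N by lia.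
rewrite !sum_arc_res ?natrB; try by lia.
by rewrite -natr1; field.
Qed.

Definition ndist (i j : nat) : nat := ((i - j) + (j - i))%N.

(** As a function of [d], [d (k - d) / k] has constant second difference [-2 / k]; the kink of
    [|i - j|] at [j = i] accounts for the [- 2]. Where a neighbour wraps around, [arc_resC] switches
    to the other arc. *)
Lemma laplace_arc_res k i j jp jn : (2 < k)%N -> (i < k)%N -> (jp < k)%N ->
  j = (jp.+1 %% k)%N -> jn = (j.+1 %% k)%N ->
  (arc_res k (ndist i j) - arc_res k (ndist i jn)) +
  (arc_res k (ndist i j) - arc_res k (ndist i jp)) = 2 / k%:R - 2 * (j == i)%:R.
Proof.
move=> k2 ik jpk Dj Djn; have nz : k%:R != 0 :> R by rewrite pnatr_eq0; lia.
have jk : (j < k)%N by rewrite Dj ltn_pmod //; lia.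
have Ej : j = 0%N /\ jp = k.-1 \/ j = jp.+1.
  case: (ltnP jp.+1 k) => H; first by right; rewrite Dj modn_small.
  have E : jp.+1 = k by lia.
  by left; split; [rewrite Dj E modnn|rewrite -E].
have Ejn : jn = 0%N /\ j = k.-1 \/ jn = j.+1 /\ (j.+1 < k)%N.
  case: (ltnP j.+1 k) => H; first by right; rewrite Djn modn_small.
  have E : j.+1 = k by lia.
  by left; split; [rewrite Djn E modnn|rewrite -E].
have E1 : arc_res k (ndist i jn) =
    arc_res k (if (j < i)%N then (ndist i j).-1 else (ndist i j).+1).
  case: Ejn => [[-> Dj']|[-> _]].
    case: ltnP => H; first by have -> : ndist i 0 = (ndist i j).-1 by rewrite /ndist; lia.
    rewrite -[LHS]arc_resC; try (by rewrite /ndist; lia).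
    by congr arc_res; rewrite /ndist; lia.
  by congr arc_res; case: ltnP => H; rewrite /ndist; lia.
have E2 : arc_res k (ndist i jp) =
    arc_res k (if (j <= i)%N then (ndist i j).+1 else (ndist i j).-1).
  case: Ej => [[Dj' ->]|Dj'].
    case: leqP => H; last by lia.
    rewrite -[LHS]arc_resC; try (by rewrite /ndist; lia).
    by congr arc_res; rewrite /ndist; lia.
  by congr arc_res; case: leqP => H; rewrite /ndist; lia.
rewrite E1 E2; case: (ltngtP j i) => [ji|ij|->] /=.
- have : (0 < ndist i j)%N by rewrite /ndist; lia.
  by case: (ndist i j) => // d _; rewrite /arc_res /= -!natr1; field.
- have : (0 < ndist i j)%N by rewrite /ndist; lia.
  by case: (ndist i j) => // d _; rewrite /arc_res /= -!natr1; field.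
have -> : ndist i i = 0%N by rewrite /ndist; lia.
by rewrite /arc_res /=; field.
Qed.

Lemma index_next (T : eqType) (c : seq T) x : uniq c -> x \in c ->
  index (next c x) c = ((index x c).+1 %% size c)%N.
Proof.
move=> cu xc; rewrite next_nth xc; case: c cu xc => // y p cu xc.
set i := index x _; have : (i < (size p).+1)%N by rewrite -[(size p).+1]/(size (y :: p)) index_mem.
rewrite ltnS leq_eqVlt => /orP[/eqP Di|ip].
  by rewrite nth_default ?Di // modnn /= eqxx.
rewrite modn_small //; rewrite -[nth y p i]/(nth y (y :: p) i.+1) index_uniq //.
Qed.

End CycleKernel.

Section BlockKernel.
Variables (R : realFieldType) (G : sgraph).

(* An edge is not a 2-cycle: its resistance is 1 rather than 1/2. *)
Definition row_res (k : nat) : R := if k == 2%N then 1 else (k%:R ^+ 2 - 1) / 6.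

(** [2 / #|B|] is forced: for fixed [a] the left-hand sides sum to zero over [x] in [B]. Being
    independent of [a], it goes into the [K] of [resistance_kernel]. The bound [2 / 3] is attained
    in a triangle. *)
Definition block_kernel (B : {set G}) (r : G -> G -> R) :=
  [/\ (forall x y, r x y = r y x), (forall x, r x x = 0),
      (forall a x, a \in B -> x \in B ->
        \sum_(y in B | x -- y) (r a x - r a y) = 2 / #|B|%:R - 2 * (x == a)%:R),
      (forall a, a \in B -> \sum_(b in B) r a b = row_res #|B|) &
      (forall a b, a \in B -> b \in B -> a != b -> 2 / 3 <= r a b)].

Lemma edge_block_kernel (B : {set G}) : edge_block B -> exists r, block_kernel B r.
Proof.
case=> p [q [pq ->]]; have npq := edge_neq pq; exists (fun a b => (a != b)%:R).
have nqp : q != p by rewrite eq_sym.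
have S2 (F : G -> R) : \sum_(b in [set p; q]) F b = F p + F q.
  by rewrite big_setU1 ?inE //= big_set1.
rewrite /block_kernel cards2 npq /row_res /=; split=> //.
- by move=> x y; rewrite eq_sym.
- by move=> x; rewrite eqxx.
- move=> a x aB xB; rewrite big_mkcondr /= S2.
  by case/set2P: aB => ->; case/set2P: xB => ->;
    rewrite ?adj_irr ?(adj_sym q p) ?pq ?eqxx ?npq ?nqp ?(negbTE npq) ?(negbTE nqp) /=; field.
- by move=> a /set2P[]->; rewrite S2 ?eqxx ?npq ?nqp /= ?addr0 ?add0r.
- by move=> a b _ _ -> /=; lra.
Qed.

Lemma cycle_block_kernel (B : {set G}) : cycle_block B -> exists r, block_kernel B r.
Proof.
case=> c [cP Bc Bind]; have cu := cycle_uniq cP; have c2 := cycle_size cP.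
have kB : #|B| = size c by rewrite Bc card_cycle_set.
have mB x : (x \in B) = (x \in c) by rewrite Bc inE.
exists (fun a b => arc_res R (size c) (ndist (index a c) (index b c))).
rewrite /block_kernel kB /row_res gtn_eqF //; split=> [x y|x|a x|a|a b].
- by congr arc_res; rewrite /ndist addnC.
- by rewrite /ndist subnn /arc_res mul0r mul0r.
- move=> aB xB; have xc : x \in c by rewrite -mB.
  rewrite (eq_bigl [in [set next c x; prev c x]]); last first.
    by move=> y; rewrite -(cycle_block_nbr cP Bc Bind xB) inE.
  rewrite big_setU1 /= ?inE ?next_neq_prev // big_set1.
  rewrite (laplace_arc_res R (i := index a c) (jp := index (prev c x) c)) ?index_mem -?mB //.
  + congr (_ - _ * (nat_of_bool _)%:R); apply/eqP/eqP => [|->//].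
    by apply: index_inj; rewrite ?inE -?mB.
  + by rewrite mB mem_prev.
  + by rewrite -index_next ?next_prev ?mem_prev.
  + by rewrite -index_next.
- move=> aB; rewrite -(row_arc_res R (k := size c) (i := index a c)) ?index_mem -?mB //.
  rewrite (eq_bigl [in c]) // -big_uniq //= (big_nth a) /= big_nat [RHS]big_nat.
  by apply: eq_bigr => j /andP[_ jc]; rewrite index_uniq.
move=> aB bB nab; apply: arc_res_ge => //; rewrite !mB in aB bB.
have : index a c != index b c by apply: contra nab => /eqP/index_inj->.
move: aB bB; rewrite -!index_mem /ndist.
by move: (index a c) (index b c) (size c) => i j k; lia.
Qed.

End BlockKernel.

(** * Decomposition of the degree resistance distance *)

Section Excess.
Variables (R : realFieldType) (G : sgraph) (BB : {set {set G}}) (pi : {set G} -> G -> G).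
Hypothesis Gg : gated BB pi.
Variable r : {set G} -> G -> G -> R.
Hypothesis rK : forall B, B \in BB -> block_kernel B (r B).

Let rho u v := \sum_(B in BB) r B (pi B u) (pi B v).

(** Along an edge only the block containing it changes gates, so the Laplacian of [rho] at [x] is
    the sum of those of the blocks at [x]. By [card_block_toward], [a] has gate [x] in all of these
    blocks if [x = a], and in all but one otherwise; hence the [- 1] in [K]. *)
Lemma resistance_blocks u v : resistance R u v = rho u v.
Proof.
pose K x : R := \sum_(B in BB | x \in B) 2 / #|B|%:R -
  2 * ((\sum_(B in BB | x \in B) 1) - 1).
apply: (resistance_kernel (rho := rho) (K := K) u v (gated_conn Gg)).
- by move=> x y; apply: eq_bigr => B /rK[rC _ _ _ _].
- by move=> x; apply: big1 => B /rK[_ r0 _ _ _].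
move=> a x.
transitivity (\sum_(B in BB | x \in B) (2 / #|B|%:R - 2 * (x == pi B a)%:R : R)).
  under eq_bigr do rewrite -sumrB.
  rewrite exchange_big [RHS]big_mkcondr /=; apply: eq_bigr => B BBB.
  have [_ _ rL _ _] := rK BBB.
  have [xB|xB] := ifPn (x \in B); last first.
    apply: big1 => y xy; rewrite (gated_out Gg BBB xy) ?subrr //.
    by rewrite (negbTE xB).
  rewrite -rL ?(gated_in Gg) // (bigID [in B]) /= addrC big1 ?add0r.
    by apply: eq_big => [y|y /andP[_ yB]];
      [rewrite andbC | rewrite (gated_id Gg BBB xB) (gated_id Gg BBB yB)].
  move=> y /andP[xy yB]; rewrite (gated_out Gg BBB xy) ?subrr //.
  by rewrite (negbTE yB) andbF.
rewrite sumrB -[X in _ - X]mulr_sumr /K; have := card_block_toward Gg a x.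
rewrite -sum1_card => E.
have {}E : \sum_(B in BB | x \in B) (x != pi B a)%:R = (x != a)%:R :> R.
  rewrite -E natr_sum big_mkcond [RHS]big_mkcond /=; apply: eq_bigr => B _.
  by rewrite inE eq_sym; case: (B \in BB); case: (x \in B); case: (_ == _).
have : \sum_(B in BB | x \in B) (x == pi B a)%:R + \sum_(B in BB | x \in B) (x != pi B a)%:R
    = \sum_(B in BB | x \in B) 1 :> R.
  by rewrite -big_split; apply: eq_bigr => B _ /=; case: (_ == _); rewrite ?addr0 ?add0r.
rewrite E => <-; case: (x == a) => /=; ring.
Qed.

Definition hang_excess (B : {set G}) : R :=
  2 * \sum_(a in B) \sum_(b in B)
    r B a b * ((hang pi B a + hang_cycles BB pi B a) * hang pi B b)%:R.

(** After grouping by gates, the weight of [r B a b] is [(k + 2 x_a + 2 c_a) (x_b + 1)] with [k] the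
    inner degree. Its terms that involve only [a] or only [b] meet the constant row sums of [r B],
    so only the totals of [x] and [c] survive in them. *)
Lemma DR_blocks : DR R G = \sum_(B in BB)
  (row_res R #|B| * (inner_deg B * #|B| + (inner_deg B + 2) * (#|G| - #|B|)
                     + 2 * (#|cycles G| - (2 < #|B|)%N))%:R + hang_excess B).
Proof.
rewrite (DR_ordered resistance_blocks); last first.
- by move=> x; apply: big1 => B /rK[_ r0 _ _ _].
- by move=> x y; apply: eq_bigr => B /rK[rC _ _ _ _].
transitivity (\sum_(B in BB) \sum_u \sum_v (deg u)%:R * r B (pi B u) (pi B v)).
  rewrite [RHS]exchange_big; apply: eq_bigr => u _ /=.
  rewrite [RHS]exchange_big; apply: eq_bigr => v _ /=.
  by rewrite mulr_sumr.
apply: eq_bigr => B BBB; have [rC r0 _ rS _] := rK BBB.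
transitivity (\sum_(a in B) \sum_(b in B) r B a b *
   ((inner_deg B + 2 * hang pi B a + 2 * hang_cycles BB pi B a) * (hang pi B b).+1)%:R).
  rewrite (partition_big (pi B) [in B]) /=; last by move=> x _; apply: (gated_in Gg).
  apply: eq_bigr => a aB.
  transitivity (\sum_(u in fiber pi B a) (deg u)%:R * \sum_(b in B) r B a b * (hang pi B b).+1%:R).
    apply: eq_big => [u|u /eqP->]; first by rewrite inE.
    rewrite (partition_big (pi B) [in B]) /=; last by move=> x _; apply: (gated_in Gg).
    rewrite mulr_sumr; apply: eq_bigr => b bB; rewrite -(card_fiber Gg) // mulrA mulr_natr.
    by rewrite -[RHS]sumr_const; apply: eq_big => [v|v /eqP->]; rewrite ?inE.
  rewrite -mulr_suml -natr_sum (sum_deg_fiber Gg) // mulr_sumr.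
  by apply: eq_bigr => b bB; rewrite natrM; ring.
pose X := (\sum_(a in B) hang pi B a)%N; pose C := (\sum_(a in B) hang_cycles BB pi B a)%N.
have -> : (#|G| - #|B|)%N = X by rewrite -(sum_hang Gg BBB) addnK.
have -> : (#|cycles G| - (2 < #|B|))%N = C by rewrite -(sum_hang_cycles Gg BBB) addnK.
set k := inner_deg B.
transitivity (\sum_(a in B) \sum_(b in B) r B a b * (k + 2 * hang pi B a + 2 * hang_cycles BB pi B a)%:R
  + \sum_(a in B) \sum_(b in B) r B a b * (k * hang pi B b)%:R + hang_excess B).
  rewrite /hang_excess mulr_sumr -!big_split /=; apply: eq_bigr => a _.
  rewrite mulr_sumr -!big_split /=; apply: eq_bigr => b _.
  by rewrite !(natrM, natrD) -[(hang pi B b).+1%:R]natr1; ring.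
congr (_ + _); rewrite [X in _ + X]exchange_big /=.
under eq_bigr => a aB do rewrite -mulr_suml rS //.
under [X in _ + X]eq_bigr => b bB do rewrite -mulr_suml (eq_bigr _ (fun x _ => rC x b)) rS //.
rewrite -!mulr_sumr -mulrDr -!natr_sum -natrD; congr (_ * _%:R).
by rewrite !big_split /= sum_nat_const -!big_distrr /= -/X -/C !big1_eq; ring.
Qed.

End Excess.

(** * Lower bounds for the excess of a block *)

(** Every [a] sees [p] or [q] elsewhere, which settles the [c] terms. For the others, [y a >= x p]
    when [a != p], so the sum is at least [2 * x p * y p]; both factors are positive with sum the
    total, hence their product is at least the total minus one. *)
Lemma cross_sum_ge (T : finType) (B : {set T}) (x c : T -> nat) (p q : T) :
  p \in B -> q \in B -> p != q -> (0 < x p)%N -> (0 < x q)%N ->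
  (2 * (\sum_(a in B) x a).-1 + \sum_(a in B) c a <=
   \sum_(a in B) \sum_(b in B | b != a) (x a + c a) * x b)%N.
Proof.
move=> pB qB npq xp xq; pose y a := (\sum_(b in B | b != a) x b)%N.
have xy a : a \in B -> (\sum_(a in B) x a = x a + y a)%N by move=> aB; rewrite (bigD1 a).
have y_ge a b : b \in B -> b != a -> (x b <= y a)%N.
  by move=> bB nba; rewrite /y (bigD1 b) ?bB //= leq_addr.
have -> : (\sum_(a in B) \sum_(b in B | b != a) (x a + c a) * x b =
   \sum_(a in B) x a * y a + \sum_(a in B) c a * y a)%N.
  by rewrite -big_split /=; apply: eq_bigr => a _; rewrite -mulnDl big_distrr.
apply: leq_add; last first.
  apply: leq_sum => a aB; rewrite -[leqLHS]muln1 leq_mul2l; apply/orP; right.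
  have [->|nap] := eqVneq a p; first by apply: leq_trans xq (y_ge _ _ qB _); rewrite eq_sym.
  by apply: leq_trans xp (y_ge _ _ pB _); rewrite eq_sym.
rewrite (xy p pB) (bigD1 p) //=.
have : (y p * x p <= \sum_(a in B | a != p) x a * y a)%N.
  rewrite big_distrl /=; apply: leq_sum => a /andP[aB nap].
  by rewrite leq_mul2l y_ge ?orbT // eq_sym.
have : (0 < y p)%N by apply: leq_trans xq (y_ge _ _ qB _); rewrite eq_sym.
nia.
Qed.

Lemma card3_set (T : finType) (B : {set T}) a b : #|B| = 3%N -> a \in B -> b \in B ->
  a != b -> exists2 c, B = [set a; b; c] & (a != c) && (b != c).
Proof.
move=> B3 aB bB nab; have : (0 < #|B :\: [set a; b]|)%N.
  by rewrite cardsDS ?cards2 ?B3 ?nab // subUset !sub1set aB.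
case/card_gt0P=> c; rewrite !inE negb_or => /andP[/andP[nca ncb] cB].
exists c; last by rewrite eq_sym nca eq_sym.
apply/esym/eqP; rewrite eqEcard !subUset !sub1set aB bB cB /= B3.
by rewrite setUC cardsU1 cards2 nab !inE negb_or nca ncb.
Qed.

Lemma big_set3 (S : Type) (idx : S) (op : Monoid.com_law idx) (T : finType) (F : T -> S) a b c :
  a != b -> a != c -> b != c ->
  \big[op/idx]_(i in [set a; b; c]) F i = op (F a) (op (F b) (F c)).
Proof.
move=> nab nac nbc; rewrite -setUA big_setU1 ?inE ?negb_or ?nab //=.
by rewrite big_setU1 ?inE //= big_set1.
Qed.

Section Numbers.
Variable R : realFieldType.
Implicit Types n t k : nat.

(** [3 n - 4 + 2 t] is the share of a pendent edge and [8 / 3 * (2 n + t - 4)] that of a pendent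
    triangle. The edge share is charged [n - 1] times, once per unit of [#|B| - 1]; a triangle uses
    two units, whence the correction for each of the [t] cycles. *)
Definition min_DR n t : R := (n%:R - 1) * (3 * n%:R - 4 + 2 * t%:R)
  + t%:R * (8 / 3 * (2 * n%:R + t%:R - 4) - 2 * (3 * n%:R - 4 + 2 * t%:R)).

(* Cost of replacing a pendent triangle and k - 3 pendent edges by a pendent k-cycle. *)
Definition length_excess n t k : R := if (k <= 3)%N then 0 else
  let j := k%:R - 3 in
  j * (3 * n%:R + 2 * n%:R * j + j * t%:R - 20 - 10 * j - j ^+ 2) / 3.

(** This is [4/3 * (2 (n - 4) + (t - 1))]: one triangle carries [n - 4] vertices and the other
    [t - 1] cycles at one corner, and a single vertex at another. *)
Definition G4_excess n t : R := (8 * n%:R + 4 * t%:R - 36) / 3.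
Definition G5_excess n t : R := (5 * n%:R + t%:R - 31) / 3.

Lemma length_excess4 n t : length_excess n t 4 = G5_excess n t.
Proof. by rewrite /length_excess /G5_excess /=; field. Qed.

Lemma length_excess_gt n t k : (25 <= n)%N -> (4 < k <= n)%N ->
  G4_excess n t < length_excess n t k.
Proof.
move=> n25 /andP[k4 kn]; rewrite /length_excess leqNgt (ltn_trans _ k4) //= /G4_excess.
set j := k%:R - 3; set N := n%:R; set t' := t%:R.
have j2 : 2 <= j by rewrite /j lerBrDr -(natrD R 2 3) ler_nat.
have jn : j + 3 <= N by rewrite /j subrK ler_nat.
have n25' : 25 <= N by rewrite ler_nat.
have t0 : 0 <= t' by apply: ler0n.
rewrite ltr_pM2r ?invr_gt0 ?ltr0n //.
have A : 5 * N + 2 * t' - 34 <= 3 * N + 2 * N * j + j * t' - 20 - 10 * j - j ^+ 2.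
  (* The second factor is at least [N - 7] because [j <= N - 3]. *)
  have B1 : 2 * (N - 7) <= j * (2 * N - j - 10) by apply: ler_pM; lra.
  have B2 : 2 * t' <= j * t' by apply: ler_wpM2r.
  by nra.
have : 2 * (5 * N + 2 * t' - 34) <=
  j * (3 * N + 2 * N * j + j * t' - 20 - 10 * j - j ^+ 2) by apply: ler_pM; lra.
lra.
Qed.
End Numbers.

Section ExcessBounds.
Variables (R : realFieldType) (G : sgraph) (BB : {set {set G}}) (pi : {set G} -> G -> G).
Hypothesis Gg : gated BB pi.
Variable r : {set G} -> G -> G -> R.
Hypothesis rK : forall B, B \in BB -> block_kernel B (r B).
Local Notation hang := (hang pi).
Local Notation hang_cycles := (hang_cycles BB pi).
Local Notation hang_excess := (hang_excess BB pi r).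

(** Testing [hang] is enough: where no vertex hangs, no cycle does ([hang_cycles0]). *)
Definition pendent (B : {set G}) :=
  [exists a in B, [forall b in B, (b != a) ==> (hang B b == 0)%N]].

Lemma pendentP (B : {set G}) :
  reflect (exists2 a, a \in B & {in B, forall b, b != a -> hang B b = 0%N}) (pendent B).
Proof.
apply: (iffP exists_inP) => -[a aB aP]; exists a => //.
  by move=> b bB nba; move/forall_inP/(_ b bB): aP; rewrite nba => /eqP.
by apply/forall_inP => b bB; apply/implyP => nba; rewrite aP.
Qed.

Lemma not_pendentP (B : {set G}) : B \in BB -> ~~ pendent B ->
  exists p q, [/\ p \in B, q \in B, p != q, (0 < hang B p)%N & (0 < hang B q)%N].
Proof.
move=> BBB nP; have [a aB] : exists a, a \in B.
  by have /and3P[/set0Pn] := gated_nonseparable Gg BBB.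
have [p /and3P[pB _ xp]] : exists p, [&& p \in B, p != a & (0 < hang B p)%N].
  apply/existsP; apply: contraNT nP => /existsPn N; apply/pendentP; exists a => // b bB nba.
  by have := N b; rewrite bB nba lt0n negbK => /eqP.
have [q /and3P[qB nqp xq]] : exists q, [&& q \in B, q != p & (0 < hang B q)%N].
  apply/existsP; apply: contraNT nP => /existsPn N; apply/pendentP; exists p => // b bB nba.
  by have := N b; rewrite bB nba lt0n negbK => /eqP.
by exists q, p.
Qed.

Lemma hang_cycles0 (B : {set G}) a : B \in BB -> a \in B -> hang B a = 0%N -> hang_cycles B a = 0%N.
Proof. by move=> BBB aB x0; have := hang_cycles_le Gg BBB aB; lia. Qed.

Lemma pendent_excess (B : {set G}) : B \in BB -> pendent B -> hang_excess B = 0.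
Proof.
move=> BBB /pendentP[p pB pP]; rewrite /hang_excess big1 ?mulr0 // => a aB.
apply: big1 => b bB; have [nbp|nbp] := eqVneq b p; last by rewrite (pP b) // muln0 mulr0.
have [nap|nap] := eqVneq a p.
  by have [_ r0 _ _ _] := rK BBB; rewrite nap nbp r0 mul0r.
by rewrite (pP a aB nap) (hang_cycles0 BBB aB (pP a aB nap)) addn0 mul0n mulr0.
Qed.

Lemma hang_excess_ge0 (B : {set G}) : B \in BB -> 0 <= hang_excess B.
Proof.
move=> BBB; have [_ r0 _ _ rg] := rK BBB.
rewrite mulr_ge0 //; apply: sumr_ge0 => a aB; apply: sumr_ge0 => b bB.
rewrite mulr_ge0 // ?ler0n //; have [->|nab] := eqVneq a b; first by rewrite r0.
by apply: le_trans (rg a b aB bB nab); rewrite divr_ge0.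
Qed.

Definition cross (B : {set G}) := (\sum_(a in B) \sum_(b in B | b != a)
  (hang B a + hang_cycles B a) * hang B b)%N.

Lemma hang_excess_cross (B : {set G}) : B \in BB -> 4 / 3 * (cross B)%:R <= hang_excess B.
Proof.
move=> BBB; have [_ r0 _ _ rg] := rK BBB.
rewrite /hang_excess (_ : 4 / 3 = 2 * (2 / 3)); last by field.
rewrite -mulrA ler_wpM2l // natr_sum mulr_sumr; apply: ler_sum => a aB.
rewrite (bigD1 (P := [in B]) a) //= r0 mul0r add0r natr_sum mulr_sumr.
by apply: ler_sum => b /andP[bB nba]; rewrite ler_wpM2r // rg // eq_sym.
Qed.

(** The row sum is [4 / 3] and both of its nonzero terms are at least [2 / 3]. *)
Lemma triangle_res (B : {set G}) a b : B \in BB -> #|B| = 3%N -> a \in B -> b \in B -> b != a ->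
  r B a b = 2 / 3.
Proof.
move=> BBB B3 aB bB nba; have [_ r0 _ rS rg] := rK BBB.
rewrite eq_sym in nba; have [c BE /andP[nac nbc]] := card3_set B3 aB bB nba.
have cB : c \in B by rewrite BE !inE eqxx orbT.
have := rS a aB; rewrite (eq_bigl [in [set a; b; c]]); last by move=> x; rewrite -BE.
rewrite big_set3 //= r0 add0r B3 /row_res /=.
by have := rg a b aB bB nba; have := rg a c aB cB nac; lra.
Qed.

Lemma triangle_excess (B : {set G}) : B \in BB -> #|B| = 3%N -> hang_excess B = 4 / 3 * (cross B)%:R.
Proof.
move=> BBB B3; have [_ r0 _ _ rg] := rK BBB.
rewrite /hang_excess (_ : 4 / 3 = 2 * (2 / 3)); last by field.
rewrite -mulrA; congr (_ * _); rewrite natr_sum mulr_sumr; apply: eq_bigr => a aB.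
rewrite (bigD1 (P := [in B]) a) //= r0 mul0r add0r natr_sum mulr_sumr.
by apply: eq_bigr => b /andP[bB nba]; rewrite triangle_res.
Qed.

Variables (n t : nat).
Hypotheses (Gn : #|G| = n) (Gt : #|cycles G| = t) (n25 : (25 <= n)%N).

Definition block_excess (B : {set G}) : R := length_excess R n t #|B| + hang_excess B.

Lemma n_gt0 : (0 < #|G|)%N. Proof. by rewrite Gn; lia. Qed.

Lemma card_block_le (B : {set G}) : (#|B| <= n)%N.
Proof. by rewrite -Gn max_card. Qed.

(** Since [n - 1] and [t] are themselves sums over blocks, [min_DR] splits blockwise, and the
    identity is checked for an edge, a triangle and a longer cycle separately. *)
Lemma DR_excess : DR R G = min_DR R n t + \sum_(B in BB) block_excess B.
Proof.
rewrite (DR_blocks Gg rK) Gn Gt /min_DR.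
have E1 : n%:R - 1 = \sum_(B in BB) (#|B|.-1)%:R :> R.
  by rewrite -natr_sum (sum_block_size Gg n_gt0) Gn -subn1 natrB //; lia.
have E2 : t%:R = \sum_(B in BB) ((2 < #|B|)%N)%:R :> R.
  rewrite -natr_sum -Gt (gated_cycles Gg) -sum1_card big_mkcond [in RHS]big_mkcond /=.
  by congr _%:R; apply: eq_bigr => B _; rewrite inE; case: (B \in BB); case: ltnP.
transitivity ((\sum_(B in BB) (#|B|.-1)%:R) * (3 * n%:R - 4 + 2 * t%:R) +
   (\sum_(B in BB) ((2 < #|B|)%N)%:R) *
     (8 / 3 * (2 * n%:R + t%:R - 4) - 2 * (3 * n%:R - 4 + 2 * t%:R)) +
   \sum_(B in BB) block_excess B); last by rewrite -E1 -E2.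
rewrite !mulr_suml -!big_split /=; apply: eq_bigr => B BBB.
rewrite /block_excess addrA; congr (_ + _).
have := gated_card_gt1 Gg BBB; have := card_block_le B.
have ct : ((2 < #|B|) <= t)%N by rewrite -Gt -(sum_hang_cycles Gg BBB) leq_addl.
move: ct; rewrite /row_res /inner_deg /length_excess; case: (eqVneq #|B| 2) => [->|n2] /= ct kn k1.
  by rewrite subn0 !natrD !natrM natrB //; ring.
have k2 : (2 < #|B|)%N by lia.
rewrite k2 in ct *; rewrite -subn1 (natrB _ (ltnW k1)) !natrD (natrB _ kn) (natrB _ ct) /=.
by case: leqP => k3; [have -> : #|B| = 3%N by lia | ]; field.
Qed.

Lemma cross_ge (B : {set G}) : B \in BB -> ~~ pendent B ->
  (2 * n - 2 * #|B| - 2 + (t - (2 < #|B|)) <= cross B /\ #|B| + 2 <= n)%N.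
Proof.
move=> BBB /(not_pendentP BBB)[p [q [pB qB npq xp xq]]].
have := cross_sum_ge (hang_cycles B) pB qB npq xp xq.
have := sum_hang Gg BBB; have := sum_hang_cycles Gg BBB; rewrite Gn Gt -/(cross B).
have : (2 <= \sum_(a in B) hang B a)%N.
  rewrite (bigD1 p) //= (bigD1 q) /= ?qB 1?eq_sym //; lia.
lia.
Qed.

(* Models the triangle of G4 that carries the moved pendent vertex. *)
Definition off_by_one (B : {set G}) := exists a b c, [/\ B = [set a; b; c], uniq [:: a; b; c],
  hang B a = (n - 4)%N, hang B b = 1%N & hang B c = 0%N].

Lemma cross_triangle (B : {set G}) : B \in BB -> #|B| = 3%N -> ~~ pendent B ->
  (cross B <= 2 * (n - 4) + (t - 1))%N -> off_by_one B.
Proof.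
move=> BBB B3 /(not_pendentP BBB)[p [q [pB qB npq xp xq]]].
have [s BE /andP[nps nqs]] := card3_set B3 pB qB npq.
have crossE : cross B = (\sum_(a in B) (hang B a + hang_cycles B a) *
    (\sum_(b in B) hang B b - hang B a))%N.
  apply: eq_bigr => a aB; rewrite -big_distrr /=; congr (_ * _)%N.
  by rewrite [in RHS](bigD1 a) //= addKn.
have := sum_hang Gg BBB; have := sum_hang_cycles Gg BBB; rewrite crossE Gn Gt B3 {crossE}.
have S3 (F : G -> nat) : (\sum_(a in B) F a = F p + (F q + F s))%N.
  by rewrite BE big_set3.
rewrite !S3.
move: xp xq; set x := hang B p; set y := hang B q; set z := hang B s => x0 y0 Et En le.
have [z0 xy1] : z = 0%N /\ (x = 1%N \/ y = 1%N).
  move: le Et En; set u := hang_cycles B p; set v := hang_cycles B q; set w := hang_cycles B s.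
  clearbody x y z u v w => le Et En.
  have e1 : (x + (y + z) - x = y + z)%N by lia.
  have e2 : (x + (y + z) - y = x + z)%N by lia.
  have e3 : (x + (y + z) - z = x + y)%N by lia.
  rewrite {}e1 {}e2 {}e3 -Et -En in le.
  (* Each of [u], [v], [w] has a positive cofactor, so the cycle terms cancel against [t - 1]. What
     is left says [(x - 1) (y - 1) + z (x + y - 1) <= 0], which forces [z = 0] and [x = 1] or
     [y = 1]. *)
  have : (x * (y + z) + y * (x + z) + z * (x + y) <= 2 * (x + (y + z) - 1))%N by nia.
  nia.
case: xy1 => [x1|y1]; [exists q, p, s | exists p, q, s]; split=> //; try lia.
- by rewrite BE [[set p; q]]setUC.
- by rewrite /= !inE negb_or nqs nps eq_sym npq.
by rewrite /= !inE negb_or npq nps nqs.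
Qed.

End ExcessBounds.

(** * Block patterns of small total excess *)

Section Profiles.
Variables (R : realFieldType) (G : sgraph) (BB : {set {set G}}) (pi : {set G} -> G -> G).
Hypothesis Gg : gated BB pi.
Variables (n t : nat).
Hypotheses (Gn : #|G| = n) (Gt : #|cycles G| = t) (n25 : (25 <= n)%N).

(** The patterns of total excess [0], [G5_excess] and [G4_excess]; any other costs more than
    [G4_excess] ([DR_profiles]). Pendent blocks with at most three vertices are those of excess
    zero. *)
Definition profile0 := {in BB, forall B : {set G}, pendent pi B /\ (#|B| <= 3)%N}.
Definition profile5 (B0 : {set G}) := [/\ B0 \in BB, #|B0| = 4%N, pendent pi B0 &
  {in BB, forall B, B != B0 -> pendent pi B /\ (#|B| <= 3)%N}].
Definition profile4 (B0 : {set G}) := [/\ B0 \in BB, #|B0| = 3%N, off_by_one pi n B0 &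
  {in BB, forall B, B != B0 -> pendent pi B /\ (#|B| <= 3)%N}].

Section Kernels.
Variable r : {set G} -> G -> G -> R.
Hypothesis rK : forall B, B \in BB -> block_kernel B (r B).
Local Notation excess := (block_excess BB pi r n t).

Lemma excess0 B : B \in BB -> pendent pi B -> (#|B| <= 3)%N -> excess B = 0.
Proof.
by move=> BBB Bp B3; rewrite /block_excess /length_excess B3 (pendent_excess Gg rK) ?addr0.
Qed.

Lemma excess5 B : B \in BB -> pendent pi B -> #|B| = 4%N -> excess B = G5_excess R n t.
Proof.
by move=> BBB Bp B4; rewrite /block_excess B4 length_excess4 (pendent_excess Gg rK) ?addr0.
Qed.

Lemma excess4 B : B \in BB -> #|B| = 3%N -> off_by_one pi n B -> excess B = G4_excess R n t.
Proof.
move=> BBB B3 [a [b [c [BE U xa xb xc]]]].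
rewrite /block_excess /length_excess B3 /= add0r (triangle_excess pi rK) //.
move: U; rewrite /= !inE !negb_or andbT => /andP[/andP[nab nac] nbc].
have S3 (F : G -> nat) : (\sum_(i in B) F i = F a + (F b + F c))%N.
  by rewrite BE big_set3.
have [aB bB cB] : [/\ a \in B, b \in B & c \in B] by rewrite BE !inE !eqxx !orbT.
have crossE : cross BB pi B = (\sum_(i in B) (hang pi B i + hang_cycles BB pi B i) *
    (\sum_(j in B) hang pi B j - hang pi B i))%N.
  apply: eq_bigr => i iB; rewrite -big_distrr /=; congr (_ * _)%N.
  by rewrite [in RHS](bigD1 i) //= addKn.
have := sum_hang_cycles Gg BBB; rewrite crossE !S3 xa xb xc Gt B3 /=.
(* At most one vertex hangs at [b] and none at [c], so no cycle does; the other [t - 1] cycles all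
   lie beyond [a]. *)
have := hang_cycles_le Gg BBB bB; have := hang_cycles_le Gg BBB cB; rewrite xb xc.
move: (hang_cycles _ _ _ a) (hang_cycles _ _ _ b) (hang_cycles _ _ _ c) => u v w w0 v0 Et.
have -> : ((n - 4 + u) * (n - 4 + (1 + 0) - (n - 4)) +
   ((1 + v) * (n - 4 + (1 + 0) - 1) + (0 + w) * (n - 4 + (1 + 0) - 0)) = (n - 4) * 2 + u)%N by nia.
have -> : u = (t - 1)%N by lia.
by rewrite /G4_excess natrD natrM !natrB; [field | lia | lia].
Qed.

Lemma excess_ge0 B : B \in BB -> 0 <= excess B.
Proof.
move=> BBB; apply: addr_ge0 (hang_excess_ge0 pi rK BBB).
have Bn := card_block_le Gn B; have n25R : 25 <= n%:R :> R by rewrite ler_nat.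
have t0 : 0 <= t%:R :> R by apply: ler0n.
case: (ltngtP #|B| 4) => [B3|B5|->]; first by rewrite /length_excess -ltnS B3.
  by apply: ltW; apply: le_lt_trans (length_excess_gt _ _ n25 _); rewrite /G4_excess ?B5 //; lra.
by rewrite length_excess4 /G5_excess; lra.
Qed.

Lemma excess_large B : B \in BB -> (4 < #|B|)%N -> G4_excess R n t < excess B.
Proof.
move=> BBB B5; apply: ltr_wpDr (hang_excess_ge0 pi rK BBB) _.
by apply: length_excess_gt; rewrite // B5 card_block_le.
Qed.

(** Five or more vertices cost enough by length alone, an edge has the larger crossing
    [2 n - 6 + t], and a 4-cycle pays for length and crossing. Only a triangle of least crossing can
    tie. *)
Lemma excess_not_pendent B : B \in BB -> ~~ pendent pi B ->
  G4_excess R n t < excess B \/ #|B| = 3%N /\ off_by_one pi n B.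
Proof.
move=> BBB nP; have := hang_excess_cross pi rK BBB.
have [] := cross_ge Gg Gn Gt n25 BBB nP; have := gated_card_gt1 Gg BBB.
have n25R : 25 <= n%:R :> R by rewrite ler_nat.
have ct : ((2 < #|B|) <= t)%N by rewrite -Gt -(sum_hang_cycles Gg BBB) leq_addl.
have t0 : 0 <= t%:R :> R by apply: ler0n.
have [B5|] := ltnP 4 #|B|; first by left; apply: excess_large.
rewrite /block_excess /G4_excess.
case EB: #|B| => [|[|[|[|[|//]]]]] // _ _ cg _ hg; rewrite EB /= in ct.
- left; have : 2 * n%:R - 6 + t%:R <= (cross BB pi B)%:R :> R.
    rewrite -(ler_nat R) in cg; apply: le_trans cg.
    by rewrite !natrD !natrB ?natrM //=; [lra | lia | lia].
  by rewrite /length_excess /=; lra.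
- have [cl|cl] := leqP (cross BB pi B) (2 * (n - 4) + (t - 1)).
    by right; split=> //; apply: (cross_triangle Gg Gn Gt n25 BBB).
  left; have : 2 * (n%:R - 4) + (t%:R - 1) + 1 <= (cross BB pi B)%:R :> R.
    rewrite -addn1 -(ler_nat R) in cl; apply: le_trans cl.
    by rewrite !natrD ?natrM !natrB //=; [lra | lia].
  by rewrite /length_excess /=; lra.
left; have : 2 * n%:R - 10 + (t%:R - 1) <= (cross BB pi B)%:R :> R.
  rewrite -(ler_nat R) in cg; apply: le_trans cg.
  by rewrite !natrD !natrB ?natrM //=; [lra | lia | lia].
by rewrite length_excess4 /G5_excess; lra.
Qed.

(** In the sum of [#|B| - 1], which is [n - 1], every cycle takes at least two and the two large
    ones at least three. *)
Lemma two_large B B' : B \in BB -> B' \in BB -> B != B' -> (3 < #|B|)%N -> (3 < #|B'|)%N ->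
  (2 * t + 3 <= n)%N.
Proof.
move=> BBB BBB' nBB' B4 B4'; have := sum_block_size Gg; rewrite Gn.
have := gated_cycles Gg; rewrite Gt -sum1_card => Et /(_ _) E.
have : (2 * t + 2 <= \sum_(B in BB) #|B|.-1)%N.
  rewrite Et big_distrr /=; under eq_bigl do rewrite inE.
  rewrite big_mkcondr /=.
  have D2 (F : {set G} -> nat) : (\sum_(i in BB) F i =
      F B + (F B' + \sum_(i in BB | (i != B) && (i != B')) F i))%N.
    rewrite (bigD1 B) //= (bigD1 B') /= ?BBB' 1?eq_sym //.
    by under eq_bigl do rewrite -andbA.
  rewrite !D2; have -> : (2 < #|B|)%N by lia.
  have -> : (2 < #|B'|)%N by lia.
  set S := (\sum_(i in BB | _) _)%N; set S' := (\sum_(i in BB | _) #|_|.-1)%N.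
  have : (S <= S')%N by apply: leq_sum => B'' _; case: ltnP; lia.
  lia.
rewrite E; lia.
Qed.

End Kernels.

Lemma block_kernels : exists r : {set G} -> G -> G -> R,
  forall B, B \in BB -> block_kernel B (r B).
Proof.
apply: (fin_all_exists (P := fun B r => B \in BB -> block_kernel B r)) => B.
have [BBB|_] := boolP (B \in BB); last by exists (fun _ _ => 0).
by have [/(edge_block_kernel R)|/(cycle_block_kernel R)] := gated_block Gg BBB;
   case=> r rP; exists r.
Qed.

Lemma sum_one_block (F : {set G} -> R) B0 : B0 \in BB ->
  {in BB, forall B, B != B0 -> F B = 0} -> \sum_(B in BB) F B = F B0.
Proof. by move=> BB0 F0; rewrite (bigD1 B0) //= big1 ?addr0 // => B /andP[]; apply: F0. Qed.

Lemma profile0_DR : profile0 -> DR R G = min_DR R n t.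
Proof.
have [r rK] := block_kernels; move=> P; rewrite (DR_excess Gg rK Gn Gt) // big1 ?addr0 // => B BBB.
by have [Bp B3] := P B BBB; rewrite excess0.
Qed.

Lemma profile5_DR B0 : profile5 B0 -> DR R G = min_DR R n t + G5_excess R n t.
Proof.
have [r rK] := block_kernels; move=> [BB0 B4 Bp P]; rewrite (DR_excess Gg rK Gn Gt) //.
rewrite (sum_one_block BB0) ?excess5 // => B BBB nB.
by have [Bp' B3] := P B BBB nB; rewrite excess0.
Qed.

Lemma profile4_DR B0 : profile4 B0 -> DR R G = min_DR R n t + G4_excess R n t.
Proof.
have [r rK] := block_kernels; move=> [BB0 B4 Bp P]; rewrite (DR_excess Gg rK Gn Gt) //.
rewrite (sum_one_block BB0) ?excess4 // => B BBB nB.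
by have [Bp' B3] := P B BBB nB; rewrite excess0.
Qed.

Lemma DR_profiles : [\/ profile0, exists B0, profile5 B0, exists B0, profile4 B0 |
  min_DR R n t + G4_excess R n t < DR R G].
Proof.
have [r rK] := block_kernels; rewrite (DR_excess Gg rK Gn Gt) // ltrD2l.
have n25R : 25 <= n%:R :> R by rewrite ler_nat.
have t0 : 0 <= t%:R :> R by apply: ler0n.
set F := fun B => block_excess BB pi r n t B.
have ge0 B : B \in BB -> 0 <= F B by apply: excess_ge0.
have ge1 B : B \in BB -> F B <= \sum_(B in BB) F B.
  by move=> BBB; rewrite (bigD1 B) //= lerDl sumr_ge0 // => B' /andP[/ge0].
have ge2 B B' : B \in BB -> B' \in BB -> B' != B -> F B + F B' <= \sum_(B in BB) F B.
  move=> BBB BBB' nBB'; rewrite (bigD1 B) //= lerD2l (bigD1 B') /= ?BBB' //.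
  by rewrite lerDl sumr_ge0 // => B'' /andP[/andP[/ge0]].
have [lt|le] := boolP (G4_excess R n t < \sum_(B in BB) F B); first by constructor 4.
have {}le : \sum_(B in BB) F B <= G4_excess R n t by rewrite leNgt.
have nP B : B \in BB -> ~~ pendent pi B -> #|B| = 3%N /\ off_by_one pi n B.
  move=> BBB /(excess_not_pendent rK BBB)[lt|//].
  by have := le_lt_trans (le_trans (ge1 B BBB) le) lt; rewrite ltxx.
have le4 B : B \in BB -> (#|B| <= 4)%N.
  move=> BBB; rewrite leqNgt; apply/negP => /(excess_large rK BBB) lt.
  by have := le_lt_trans (le_trans (ge1 B BBB) le) lt; rewrite ltxx.
case: (boolP [exists B in BB, #|B| == 4]%N) => [/exists_inP[B0 BB0 /eqP B04]|/exists_inPn N4].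
  have P0 : pendent pi B0 by apply: contraT => /(nP B0 BB0)[]; rewrite B04.
  constructor 2; exists B0; split=> // B BBB nB.
  have := ge2 B0 B BB0 BBB nB; rewrite {1}/F excess5 // => ge.
  have PB : pendent pi B.
    apply: contraT => /(nP B BBB)[B3 oB]; move: ge; rewrite /F excess4 //.
    by move/le_trans => /(_ _ le); rewrite /G4_excess /G5_excess; lra.
  split=> //; rewrite -ltnS ltn_neqAle le4 // andbT; apply/eqP => B4.
  move: ge; rewrite /F excess5 // => /le_trans/(_ le).
  (* Added to [n >= 25] this gives [2 n >= 2 t + 28]; two 4-cycles exceed [G4_excess] as soon as
     [2 n > 2 t + 26]. *)
  have : (2 * t + 3 <= n)%N by apply: (two_large BBB BB0 nB); rewrite ?B4 ?B04.
  rewrite -(ler_nat R) natrD natrM /G4_excess /G5_excess; lra.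
have le3 B : B \in BB -> (#|B| <= 3)%N.
  by move=> BBB; rewrite -ltnS ltn_neqAle N4 ?le4.
case: (boolP [exists B in BB, ~~ pendent pi B]) => [/exists_inP[B0 BB0 nP0]|/exists_inPn P].
  have [B03 oB0] := nP B0 BB0 nP0; constructor 3; exists B0; split=> // B BBB nB.
  split; last exact: le3.
  apply: contraT => /(nP B BBB)[B3 oB]; have := ge2 B0 B BB0 BBB nB.
  by rewrite /F !excess4 // => /le_trans/(_ le); rewrite /G4_excess; lra.
by constructor 1 => B BBB; split; [have := P B BBB; rewrite negbK | apply: le3].
Qed.

End Profiles.

(** * Recognizing the extremal graphs *)

Local Close Scope ring_scope.

(** On [U] the graph is a matching. Listing the matched pairs first, each at positions [2 i] and
    [2 i + 1], reproduces the triangle clause of the edge predicates of the extremal graphs up to a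
    shift. *)
Lemma matching_enum (G : sgraph) (x0 : G) (U : {set G}) :
  (forall u x y, u \in U -> x \in U -> y \in U -> u -- x -> u -- y -> x = y) ->
  exists s t, [/\ uniq s, s =i U, t.*2 <= size s & forall i j, i < j < size s ->
    (nth x0 s i -- nth x0 s j) = [&& ~~ odd i, j == i.+1 & j < t.*2]].
Proof.
have [k] := ubnP #|U|; elim: k U => // k IHk U; rewrite ltnS => Uk Um.
case: (boolP [exists x in U, exists y in U, x -- y]) => [/exists_inP[x xU /exists_inP[y yU xy]]|N].
  have nxy := edge_neq xy.
  have /IHk : #|U :\: [set x; y]| < k.
    by apply: leq_trans Uk; apply: proper_card; apply/properP; split;
      [exact: subsetDl | exists x; rewrite // !inE eqxx].
  case=> [u a b|s [t [su sU st sadj]]].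
    by rewrite !inE => /andP[_ ?] /andP[_ ?] /andP[_ ?]; apply: Um.
  have xs : x \notin s by rewrite sU !inE eqxx.
  have ys : y \notin s by rewrite sU !inE eqxx orbT.
  have out z i : i < size s -> (z == x) || (z == y) -> (z -- nth x0 s i) = false.
    move=> si zxy; have : nth x0 s i \in s by rewrite mem_nth.
    move: (nth _ _ _) => w ws; have := ws; rewrite sU !inE negb_or => /andP[/andP[nwx nwy] wU].
    apply/negP => zw; case/orP: zxy zw => /eqP-> zw.
      by rewrite (Um x w y) ?eqxx in nwy.
    by rewrite (Um y w x) ?eqxx // 1?adj_sym // in nwx.
  exists [:: x, y & s], t.+1; split=> //=.
  - by rewrite inE negb_or nxy xs ys.
  - move=> z; rewrite !inE sU !inE; case: (eqVneq z x) => [->|_]; first by rewrite xU.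
    by case: (eqVneq z y) => [->|_]; first by rewrite yU.
  case=> [|[|i]] [|[|j]] //=; rewrite ?doubleS ?ltnS //=.
  - by move=> js; rewrite out ?eqxx.
  - by move=> js; rewrite out ?eqxx ?orbT.
  by move=> ij; rewrite sadj // negbK eqSS.
exists (enum U), 0; split=> //; first exact: enum_uniq.
  by move=> x; rewrite mem_enum.
move=> i j /andP[ij js]; rewrite ltn0 !andbF; apply/negP=> xy; case/negP: N.
have mU l : l < size (enum U) -> nth x0 (enum U) l \in U.
  by move=> lU; rewrite -mem_enum mem_nth.
apply/exists_inP; exists (nth x0 (enum U) i); first by apply: mU; apply: ltn_trans js.
by apply/exists_inP; exists (nth x0 (enum U) j) => //; apply: mU.
Qed.

Lemma nat_graph_iso (G : sgraph) (x0 : G) (s : seq G) n f :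
  uniq s -> size s = n -> (forall x, x \in s) ->
  (forall i j, i < j < n -> (nth x0 s i -- nth x0 s j) = f i j) ->
  isomorphic G (nat_graph n f).
Proof.
move=> su sn sG sadj.
have sP x : index x s < n by rewrite -sn index_mem.
exists (fun x => Ordinal (sP x) : nat_graph n f).
  exists (fun i : 'I_n => nth x0 s i) => [x|i] /=; first by rewrite nth_index.
  by apply: val_inj; rewrite /= index_uniq ?sn.
move=> x y; transitivity (nth x0 s (index x s) -- nth x0 s (index y s)); last by rewrite !nth_index.
rewrite /= /nat_adj /=.
case: (ltngtP (index x s) (index y s)) => [ij|ji|->] /=.
- by rewrite orbF sadj // ij sP.
- by rewrite adj_sym sadj // ji sP.
by rewrite adj_irr.
Qed.

(** * Blocks around a common root *)

Section Petals.
Variables (G : sgraph) (BB : {set {set G}}) (pi : {set G} -> G -> G).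
Hypothesis Gg : gated BB pi.
Implicit Types (B : {set G}) (u v w x y : G).

(** Up to three vertices, the inner degree equals [#|B| - 1]. *)
Lemma small_block_complete B x y : B \in BB -> #|B| <= 3 -> x \in B -> y \in B ->
  x != y -> x -- y.
Proof.
move=> BBB B3 xB yB nxy; have := gated_inner_deg Gg BBB xB.
have := gated_card_gt1 Gg BBB => B1.
have sub : [set y in B | x -- y] \subset B :\ x.
  apply/subsetP=> z; rewrite !inE => /andP[-> xz].
  by rewrite andbT eq_sym edge_neq.
have := cardsD1 x B; rewrite xB => E1 E2.
have : [set y in B | x -- y] == B :\ x.
  by rewrite eqEcard sub E2 /=; case: eqP; lia.
by move/eqP/setP/(_ y); rewrite !inE yB eq_sym nxy => /andP[].
Qed.

Lemma block_at u v : u != v -> exists2 B, B \in BB & u \in B.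
Proof.
move=> nuv; have := card_block_toward Gg v u; rewrite nuv => /eqP/cards1P[B /setP/(_ B)].
by rewrite !inE eqxx => /and3P[]; exists B.
Qed.

Lemma hang_gt0 B B' x : B \in BB -> B' \in BB -> B' != B -> x \in B' -> 0 < hang pi B (pi B x).
Proof.
move=> BBB BBB' nBB' xB'.
have := subset_leq_card (block_fiber Gg BBB BBB' nBB' xB').
have := gated_card_gt1 Gg BBB'; rewrite (card_fiber Gg) ?(gated_in Gg) //; lia.
Qed.

Lemma pendent_eq B x y : pendent pi B -> x \in B -> y \in B ->
  0 < hang pi B x -> 0 < hang pi B y -> x = y.
Proof.
case/pendentP=> a aB aP xB yB hx hy.
have [<-|nxa] := eqVneq a x; last by rewrite aP // eq_sym in hx.
by have [//|nya] := eqVneq a y; rewrite aP // eq_sym in hy.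
Qed.

(* If v lay outside B, the block through the gate of B towards v would carry
   B on one side and B0 on the other. *)
Lemma pendent_blocks_root B0 v : B0 \in BB -> v \in B0 ->
  {in BB, forall B, B != B0 -> B \subset fiber pi B0 v -> pendent pi B} ->
  {in BB, forall B, B != B0 -> B \subset fiber pi B0 v -> v \in B}.
Proof.
move=> BB0 vB0 P B BBB nB sB; have gB : pi B v \in B by apply: (gated_in Gg).
have [<- //|ngv] := eqVneq (pi B v) v.
have := card_block_toward Gg v (pi B v); rewrite ngv => /eqP/cards1P[B1 /setP/(_ B1)].
rewrite !inE eqxx => /and3P[BB1 gB1 nB1].
have nB1B : B != B1 by apply: contra nB1 => /eqP<-.
have g0 : pi B0 (pi B v) = v by have := subsetP sB _ gB; rewrite inE => /eqP.
have nB10 : B1 != B0.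
  apply: contra ngv => /eqP E; rewrite {}E in gB1.
  by rewrite -{2}g0 (gated_id Gg BB0 gB1).
have sB1 : B1 \subset fiber pi B0 v by rewrite -g0; apply: (block_fiber Gg).
have hg := hang_gt0 BB1 BBB nB1B gB; rewrite (gated_id Gg BB1 gB1) in hg.
have hv : 0 < hang pi B1 (pi B1 v) by apply: (@hang_gt0 _ B0); rewrite // eq_sym.
have := pendent_eq (P B1 BB1 nB10 sB1) (gated_in Gg v BB1) gB1 hv hg.
by move/eqP; rewrite (negbTE nB1).
Qed.

(** Every other block lies beyond the one vertex of [B0] that carries anything, so
    [pendent_blocks_root] applies to it. *)
Lemma star_root B0 : B0 \in BB -> {in BB, forall B, pendent pi B} ->
  exists2 v, v \in B0 & {in BB, forall B, v \in B}.
Proof.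
move=> BB0 P; have /pendentP[v vB0 vP] := P B0 BB0; exists v => // B BBB.
have [->//|nB] := eqVneq B B0.
apply: (pendent_blocks_root BB0 vB0) => // [B' BBB' _ _|]; first exact: P.
have /card_gt0P[x xB] : 0 < #|B| by apply: ltnW; apply: (gated_card_gt1 Gg).
have <- : pi B0 x = v; last exact: (block_fiber Gg).
apply/eqP/idPn => npv; have := hang_gt0 BB0 BBB nB xB.
by rewrite vP ?(gated_in Gg).
Qed.

Section At.
Variables (v : G) (U : {set G}).
Hypothesis vU : v \notin U.
Hypothesis UP : forall u B, u \in U -> B \in BB -> u \in B -> v \in B /\ #|B| <= 3.

Lemma petal_neq u : u \in U -> v != u.
Proof. by move=> uU; apply: contraNneq vU => ->. Qed.

Lemma petal_adj u : u \in U -> v -- u.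
Proof.
move=> uU; have nvu := petal_neq uU.
have [B BBB uB] : exists2 B, B \in BB & u \in B by apply: (@block_at _ v); rewrite eq_sym.
by have [vB B3] := UP uU BBB uB; apply: (small_block_complete BBB).
Qed.

(** The blocks of [u -- x] and [u -- y] share [u] and [v], hence coincide; with [x != y] this block
    would have four vertices. *)
Lemma petal_matching u x y :
  u \in U -> x \in U -> y \in U -> u -- x -> u -- y -> x = y.
Proof.
move=> uU xU yU ux uy; apply/eqP/idPn => nxy.
have [B BBB /andP[uB xB]] := gated_edge Gg ux.
have [B' BBB' /andP[uB' yB']] := gated_edge Gg uy.
have [vB B3] := UP uU BBB uB; have [vB' B3'] := UP uU BBB' uB'.
have E : B = B' by apply: (gated_eq Gg BBB BBB' (petal_neq uU)).
rewrite -E in yB'.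
have : #|[set v; u; x; y]| <= #|B|.
  by apply: subset_leq_card; rewrite !subUset !sub1set vB uB xB.
move/leq_trans/(_ B3); suff -> : #|[set v; u; x; y]| = 4 by [].
rewrite -!setUA !cardsU1 cards1 !inE !negb_or !petal_neq //= nxy.
by rewrite (edge_neq ux) (edge_neq uy).
Qed.

Lemma petal_disjoint B0 w u : B0 \in BB -> v \in B0 -> w \in B0 -> w != v ->
  u \notin B0 -> u \in U -> (w -- u) = false.
Proof.
move=> BB0 vB0 wB0 nwv uB0 uU; apply/negP => wu.
have [B BBB /andP[wB uB]] := gated_edge Gg wu; have [vB _] := UP uU BBB uB.
by rewrite (gated_eq Gg BB0 BBB nwv) // uB in uB0.
Qed.
End At.

End Petals.

Section ProfileIso.
Variables (G : sgraph) (BB : {set {set G}}) (pi : {set G} -> G -> G).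
Hypothesis Gg : gated BB pi.
Variable n : nat.
Hypotheses (Gn : #|G| = n) (n25 : 25 <= n).

Lemma size_enum_set (U : {set G}) (s : seq G) : uniq s -> s =i U -> size s = #|U|.
Proof. by move=> su sU; rewrite -(card_uniqP su); apply: eq_card. Qed.

(** Here [t] is the number of matched pairs among the vertices other than the root; that it is the
    cycle number is settled by [isomorphic_cycles]. *)
Lemma profile0_iso : profile0 BB pi ->
  exists2 t, 2 * t + 1 <= n & isomorphic G (G0 n t).
Proof.
move=> P; have [x [y nxy]] : exists x y : G, x != y.
  have : 1 < #|[set: G]| by rewrite cardsT; lia.
  by case/card_gt1P=> x [y [_ _ nxy]]; exists x, y.
have [B0 BB0 _] := block_at Gg nxy.
have [v vB0 vB] := star_root Gg BB0 (fun B BBB => (P B BBB).1).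
pose U := [set~ v].
have vU : v \notin U by rewrite !inE eqxx.
have UP u B : u \in U -> B \in BB -> u \in B -> v \in B /\ #|B| <= 3.
  by move=> _ BBB _; split; [apply: vB | case: (P B BBB)].
have [s [t [su sU st sadj]]] := matching_enum v (petal_matching Gg vU UP).
have sn : (size s).+1 = n by rewrite (size_enum_set su sU) cardsC1 Gn; lia.
exists t; first by move: st; rewrite -muln2; lia.
apply: (nat_graph_iso (x0 := v) (s := v :: s)) => //=.
- by rewrite sU !inE eqxx su.
- by move=> z; rewrite inE sU !inE; case: eqP.
rewrite -sn; case=> [|i] [|j] //= /[!ltnS] ij.
  by rewrite (petal_adj Gg vU UP) // -sU mem_nth.
by rewrite sadj.
Qed.

Lemma profile5_iso B0 : profile5 BB pi B0 ->
  exists t, [/\ 0 < t, 2 * t + 2 <= n & isomorphic G (G5 n t)].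
Proof.
case=> BB0 B04 P0 P; have [|v vB0 vB] := star_root (pi := pi) Gg BB0.
  by move=> B BBB; have [->//|/(P B BBB)[]] := eqVneq B B0.
pose U := ~: B0.
have vU : v \notin U by rewrite !inE vB0.
have UP u B : u \in U -> B \in BB -> u \in B -> v \in B /\ #|B| <= 3.
  rewrite inE => uB0 BBB uB; split; first exact: vB.
  by have [E|/(P B BBB)[]//] := eqVneq B B0; rewrite E (negbTE uB0) in uB.
have [s [t [su sU st sadj]]] := matching_enum v (petal_matching Gg vU UP).
have sn : (size s).+4 = n.
  by rewrite (size_enum_set su sU); have := cardsC B0; rewrite -/U B04 Gn; lia.
have [[x [y [_ E]]]|[c [cP Bc _]]] := gated_block Gg BB0.
  by move: B04; rewrite E cards2; case: (_ != _).
have vc : v \in c by rewrite Bc inE in vB0.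
have [i p Dp] := rot_to vc.
have cS : size (rot i c) = 4 by rewrite size_rot -(card_cycle_set cP) -Bc.
have cU : uniq (rot i c) by rewrite rot_uniq cycle_uniq.
have cC : cycle (@adj G) (rot i c) by rewrite rot_cycle; case/and3P: cP.
have {}Bc x : (x \in B0) = (x \in rot i c) by rewrite Bc inE mem_rot.
move: cS cU cC Bc; rewrite Dp; case: p {Dp} => [|a [|b [|d []]]] //= _.
rewrite !inE !negb_or !andbT => /and3P[/and3P[nva nvb nvd] /andP[nab nad] nbd].
case/and4P=> va ab bd dv Bc.
have aB : a \in B0 by rewrite Bc !inE eqxx !orbT.
have bB : b \in B0 by rewrite Bc !inE eqxx !orbT.
have dB : d \in B0 by rewrite Bc !inE eqxx !orbT.
(* Inner degree 2 leaves no room for a third neighbour. *)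
have chord x y z w : x \in B0 -> y \in B0 -> z \in B0 -> w \in B0 -> uniq [:: y; z; w] ->
    x -- y -> x -- z -> (x -- w) = false.
  move=> xB yB zB wB; rewrite /= !inE !negb_or !andbT => /andP[/andP[nyz nyw] nzw] xy xz.
  apply/negP=> xw; have := gated_inner_deg Gg BB0 xB; rewrite B04 /=.
  have : #|[set y; z; w]| <= #|[set y in B0 | x -- y]|.
    by apply: subset_leq_card; rewrite !subUset !sub1set !inE yB zB wB xy xz xw.
  suff -> : #|[set y; z; w]| = 3 by move=> le E; rewrite E in le.
  by rewrite -setUA !cardsU1 cards1 !inE !negb_or nyz nyw nzw.
have nvb' : (v -- b) = false.
  apply: (chord v a d b) => //; last by rewrite adj_sym.
  by rewrite /= !inE !negb_or nad nab eq_sym nbd.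
have nad' : (a -- d) = false.
  apply: (chord a v b d) => //; last by rewrite adj_sym.
  by rewrite /= !inE !negb_or nvb nvd nbd.
have far x u : x \in B0 -> x != v -> u \in s -> (x -- u) = false.
  rewrite sU => xB nxv uU; apply: (petal_disjoint Gg UP BB0) => //.
  by rewrite inE in uU.
(* The matched pairs give [t] triangles; the 4-cycle is one more cycle. *)
exists t.+1; split=> //; first by move: st; rewrite -muln2; clear -sn; lia.
apply: (nat_graph_iso (x0 := v) (s := [:: v, a, b, d & s])) => //=.
- rewrite !inE !negb_or nva nvb nvd nab nad nbd !sU !inE /= vB0 aB bB dB /= su.
  by [].
- move=> x; rewrite !inE sU inE Bc !inE.
  by case: (x == v); case: (x == a); case: (x == b); case: (x == d).
rewrite -sn; case=> [|[|[|[|i']]]] [|[|[|[|j]]]] //= /[!ltnS] ij.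
- by rewrite adj_sym dv.
- by rewrite (petal_adj Gg vU UP) // -sU mem_nth.
- by rewrite far ?mem_nth // eq_sym.
- by rewrite far ?mem_nth // eq_sym.
- by rewrite far ?mem_nth // eq_sym.
by rewrite sadj // /G5_edge /= !negbK doubleS !ltnS !eqSS.
Qed.

Lemma profile4_iso B0 : profile4 BB pi n B0 ->
  exists t, [/\ 0 < t, 2 * t + 2 <= n & isomorphic G (G4 n t)].
Proof.
case=> BB0 B03 [v [b [c [BE U0 hv hb hc]]]] P.
have [vB0 bB0 cB0] : [/\ v \in B0, b \in B0 & c \in B0] by rewrite BE !inE !eqxx !orbT.
move: U0; rewrite /= !inE !negb_or !andbT => /andP[/andP[nvb nvc] nbc].
(* [y] is the moved pendent vertex, the only one beyond [b]. *)
have [y Fb nyb] : exists2 y, fiber pi B0 b = [set b; y] & b != y.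
  have F2 : #|fiber pi B0 b| = 2 by rewrite (card_fiber Gg) // hb.
  have bF := fiber_root Gg BB0 bB0; have := cardsD1 b (fiber pi B0 b).
  rewrite F2 bF => -[] /esym/eqP/cards1P[y E]; exists y.
    by rewrite -(setD1K bF) E.
  have : y \in [set y] by rewrite inE.
  by rewrite -E !inE eq_sym => /andP[].
(* A block other than [B0] lies beyond [v], and then passes through [v], or beyond [b], where the
   fiber has room for one edge only; nothing lies beyond [c]. *)
have Pv : {in BB, forall B, B != B0 -> v \in B \/ B = [set b; y]}.
  move=> B BBB nB; have /card_gt0P[x xB] : 0 < #|B| by apply: ltnW; apply: (gated_card_gt1 Gg).
  have sB := block_fiber Gg BB0 BBB nB xB; have hx := hang_gt0 Gg BB0 BBB nB xB.
  have : pi B0 x \in [set v; b; c] by rewrite -BE (gated_in Gg).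
  rewrite !inE -orbA => /or3P[]/eqP E; rewrite E in sB hx.
  - left; apply: (pendent_blocks_root Gg BB0 vB0) nB sB => // B' BBB' nB' _.
    by case: (P B' BBB' nB').
  - right; apply/eqP; rewrite eqEcard -Fb sB /= (card_fiber Gg) // hb.
    exact: (gated_card_gt1 Gg).
  by rewrite hc in hx.
have yB0 : y \notin B0.
  apply: contra nyb => yB0; have : y \in fiber pi B0 b by rewrite Fb set22.
  by rewrite inE (gated_id Gg) // eq_sym.
have nvy : v != y by apply: contraNneq yB0 => <-.
have ncy : c != y by apply: contraNneq yB0 => <-.
have yP B : B \in BB -> y \in B -> B = [set b; y].
  move=> BBB yB; have nB : B != B0 by apply: contraNneq yB0 => <-.
  have [vB|//] := Pv B BBB nB.
  have := gate_const Gg BB0 BBB _ vB yB; rewrite eq_sym => /(_ nB).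
  have : y \in fiber pi B0 b by rewrite Fb set22.
  by rewrite inE (gated_id Gg BB0 vB0) => /eqP-> /eqP; rewrite (negbTE nvb).
have yb : b -- y.
  have nyv : y != v by rewrite eq_sym.
  have [B BBB yB] := block_at Gg nyv; have E := yP B BBB yB.
  by apply: (small_block_complete Gg BBB); rewrite // E ?cards2 ?nyb ?set21 ?set22.
have y_far u : u != b -> (u -- y) = false.
  move=> nub; apply/negP => uy; have [B BBB /andP[uB yB]] := gated_edge Gg uy.
  by move: uB; rewrite (yP B BBB yB) !inE (negbTE nub) (negbTE (edge_neq uy)).
pose U := ~: (y |: B0).
have vU : v \notin U by rewrite !inE vB0 orbT.
have UP u B : u \in U -> B \in BB -> u \in B -> v \in B /\ #|B| <= 3.
  rewrite !inE negb_or => /andP[nuy uB0] BBB uB.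
  have nB : B != B0 by apply: contraNneq uB0 => <-.
  split; last by case: (P B BBB nB).
  have [//|E] := Pv B BBB nB; move: uB; rewrite E !inE (negbTE nuy) orbF => /eqP ub.
  by rewrite ub bB0 in uB0.
have [s [t [su sU st sadj]]] := matching_enum v (petal_matching Gg vU UP).
have sn : (size s).+4 = n.
  rewrite (size_enum_set su sU); have := cardsC (y |: B0); rewrite -/U Gn cardsU1 yB0 B03.
  by clear; lia.
have far x u : x \in B0 -> x != v -> u \in s -> (x -- u) = false.
  rewrite sU => xB nxv uU; apply: (petal_disjoint Gg UP BB0) => //.
  by move: uU; rewrite !inE negb_or => /andP[].
have tri p q : p \in B0 -> q \in B0 -> p != q -> p -- q.
  by move=> pB qB npq; apply: (small_block_complete Gg BB0); rewrite ?B03.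
exists t.+1; split=> //; first by move: st; rewrite -muln2; clear -sn; lia.
(* [y] comes last, at the position [n - 1] of the moved vertex in [G4]. *)
apply: (nat_graph_iso (x0 := v) (s := [:: v, b, c & rcons s y])) => //=.
- rewrite !inE !mem_rcons !inE !negb_or nvb nvc nbc nvy nyb ncy !sU !inE /= vB0 bB0 cB0 /=.
  by rewrite rcons_uniq sU !inE eqxx su !orbT.
- by rewrite size_rcons.
- move=> x; rewrite !inE mem_rcons inE sU !inE BE !inE.
  by case: (x == v); case: (x == b); case: (x == c); case: (x == y).
rewrite -sn /G4_edge /=; case=> [|[|[|i]]] [|[|[|j]]] //= /[!ltnS].
- by move=> _; rewrite tri.
- by move=> _; rewrite tri.
- rewrite nth_rcons !eqSS; case: ltngtP => // js _; last by rewrite y_far.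
  by rewrite (petal_adj Gg vU UP) // -sU mem_nth.
- by move=> _; rewrite tri.
- rewrite nth_rcons !eqSS; case: ltngtP => // js _.
  by rewrite far ?mem_nth // eq_sym.
- rewrite nth_rcons !eqSS; case: ltngtP => // js _; last by rewrite y_far // eq_sym.
  by rewrite far ?mem_nth // eq_sym.
move=> /andP[ij]; rewrite !nth_rcons !eqSS; case: (ltngtP j (size s)) => // js _.
  by rewrite (ltn_trans ij js) sadj ?ij // /G0_edge /= negbK doubleS !ltnS !eqSS.
rewrite -js ij y_far //; apply: contraNneq (_ : b \notin U) => [<-|].
  by rewrite -sU mem_nth // -js.
by rewrite !inE bB0 orbT.
Qed.

End ProfileIso.

(** * Block structure of the extremal graphs *)

Lemma triangle_cycle_block (G : sgraph) (x y z : G) :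
  x -- y -> y -- z -> z -- x -> cycle_block [set x; y; z].
Proof.
move=> xy yz zx; exists [:: x; y; z].
have nxy := edge_neq xy; have nyz := edge_neq yz; have nzx := edge_neq zx.
have cP : is_cycle [:: x; y; z].
  by rewrite /is_cycle /= /ucycleb /= xy yz zx !inE negb_or nxy nyz eq_sym nzx.
split=> //; first by apply/setP=> w; rewrite !inE orbA.
move=> p q; rewrite !inE -!orbA => pB qB pq.
rewrite mem_cycle_edges ?inE //; have npq := edge_neq pq.
have C (p' q' : G) : p' != q' -> (q' == p') = false by rewrite eq_sym => /negbTE.
have E := (@eqxx G, (negbTE nxy, negbTE nyz, negbTE nzx, C x y nxy, C y z nyz, C z x nzx)).
case/or3P: pB npq {pq} => /eqP->; case/or3P: qB => /eqP->; rewrite ?eqxx // => _;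
  by rewrite /= ?E /= ?E ?orbT.
Qed.

Lemma square_cycle_block (G : sgraph) (x y z w : G) :
  x -- y -> y -- z -> z -- w -> w -- x -> x != z -> y != w ->
  (x -- z) = false -> (y -- w) = false -> cycle_block [set x; y; z; w].
Proof.
move=> xy yz zw wx nxz nyw xz yw; exists [:: x; y; z; w].
have nxy := edge_neq xy; have nyz := edge_neq yz; have nzw := edge_neq zw.
have nwx := edge_neq wx; have nxw : x != w by rewrite eq_sym.
have [zx wy] : (z -- x) = false /\ (w -- y) = false by rewrite adj_sym xz adj_sym yw.
have cP : is_cycle [:: x; y; z; w].
  rewrite /is_cycle /= /ucycleb /= xy yz zw wx !inE !negb_or.
  by rewrite nxy nxz nxw nyz nyw nzw.
split=> //; first by apply/setP=> p; rewrite !inE !orbA.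
move=> p q; rewrite !inE -!orbA => pB qB.
rewrite mem_cycle_edges ?inE //.
have C (p' q' : G) : p' != q' -> (q' == p') = false by rewrite eq_sym => /negbTE.
have E := (@eqxx G, (negbTE nxy, negbTE nxz, negbTE nxw, negbTE nyz, negbTE nyw, negbTE nzw),
  (C x y nxy, C x z nxz, C x w nxw, C y z nyz, C y w nyw, C z w nzw)).
case/or4P: pB => /eqP->; case/or4P: qB => /eqP->; rewrite ?adj_irr ?xz ?yw ?zx ?wy // => _;
  by rewrite /= ?E /= ?E ?orbT.
Qed.

(** * Petals at a root [v], with pendent vertices [Y] at a vertex [b] *)

Section Star.
Variables (G : sgraph) (v b : G) (Y : {set G}) (label : G -> nat).
Hypotheses (vY : v \notin Y) (bY : b \notin Y).
Hypothesis Yadj : forall x y, y \in Y -> (x -- y) = (x == b).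
Hypothesis labelP : forall x y, x \notin Y -> y \notin Y -> x != v -> y != v ->
  x -- y -> label x = label y.

(** Labels sort the vertices other than [v] into petals, while [v] belongs to all of them. [Y] is
    empty for [G0] and [G5], and holds the moved vertex of [G4]. *)
Definition petal u := [set x | (x \notin Y) && ((x == v) || (label x == label u))].

Hypothesis petalP : forall u, u \notin Y -> u != v ->
  edge_block (petal u) \/ cycle_block (petal u).

Definition star_blocks : {set {set G}} :=
  [set petal u | u in ~: (v |: Y)] :|: [set [set b; y] | y in Y].

(** From outside, a set is entered at [v] with two exceptions: a vertex of [Y] enters at [b] if it
    can, and an edge from [b] to [Y] that misses [v] is entered at [b]. *)
Definition star_gate (B : {set G}) x :=
  if x \in B then x else if (x \in Y) && (b \in B) then b else if v \in B then v else b.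

Lemma star_blocksP B : reflect
  ((exists u, [/\ u \notin Y, u != v & B = petal u]) \/
   (exists2 y, y \in Y & B = [set b; y])) (B \in star_blocks).
Proof.
apply: (iffP setUP) => -[].
- case/imsetP=> u; rewrite !inE negb_or => /andP[nuv uY] ->; left; by exists u.
- by case/imsetP=> y yY ->; right; exists y.
- by case=> u [uY nuv ->]; left; apply/imsetP; exists u; rewrite // !inE negb_or nuv.
- by case=> y yY ->; right; apply/imsetP; exists y.
Qed.

Lemma petal_root u : v \in petal u.
Proof. by rewrite inE vY eqxx. Qed.

Lemma petal_self u : u \notin Y -> u \in petal u.
Proof. by move=> uY; rewrite inE uY eqxx orbT. Qed.

Lemma star_edge_root y : y \in Y -> v \in [set b; y] -> v = b.
Proof. by move=> yY /set2P[//|vy]; have := vY; rewrite vy yY. Qed.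

Lemma star_gated : gated star_blocks star_gate.
Proof.
have bconn u : u \notin Y -> connect (inrel [set: G]) v u.
  move=> uY; have [->//|nuv] := eqVneq u v.
  have /and3P[_ /connected_setP con _] := edge_or_cycle_nonseparable (petalP uY nuv).
  apply: connect_sub (con v u (petal_root u) (petal_self uY)) => x y /and3P[_ _ xy].
  by apply: connect1; rewrite /inrel /= !inE xy.
split.
- apply: (@connected_root _ _ v) => u _; have [uY|/bconn//] := boolP (u \in Y).
  apply: connect_trans (bconn b bY) _; apply: connect1.
  by rewrite /inrel /= !inE Yadj // eqxx.
- move=> B /star_blocksP[[u [uY nuv ->]]|[y yY ->]]; first exact: petalP.
  by left; exists b, y; rewrite Yadj // eqxx.
- move=> x y xy.
  have Yedge p q : q \in Y -> p -- q -> exists2 B, B \in star_blocks & (p \in B) && (q \in B).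
    move=> qY; rewrite Yadj // => /eqP->; exists [set b; q]; rewrite ?set21 ?set22 //.
    by apply/star_blocksP; right; exists q.
  have [yY|yY] := boolP (y \in Y); first exact: Yedge.
  have [xY|xY] := boolP (x \in Y).
    by have [|B BBB] := Yedge y x xY; [rewrite adj_sym | rewrite andbC; exists B].
  have [xv|nxv] := eqVneq x v.
    have nyv : y != v by rewrite -xv eq_sym edge_neq.
    exists (petal y); last by rewrite xv petal_root petal_self.
    by apply/star_blocksP; left; exists y.
  exists (petal x); first by apply/star_blocksP; left; exists x.
  rewrite petal_self // inE yY /=; have [//|nyv] := eqVneq y v.
  by rewrite (labelP xY yY) ?eqxx.
- move=> B x BBB; rewrite /star_gate; case: ifP => // _; case: ifP => [/andP[]//|_].
  case: ifP => // vB; case/star_blocksP: BBB vB => [[u [_ _ ->]]|[y _ -> _]].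
    by rewrite petal_root.
  exact: set21.
- by move=> B x BBB xB; rewrite /star_gate xB.
move=> B x y BBB; wlog: x y / (y \notin B).
  move=> W xy nxy; have [yB|yB] := boolP (y \in B); last exact: W.
  by apply/esym/W; rewrite 1?adj_sym // 1?andbC //; rewrite yB andbT in nxy.
move=> yB xy _; rewrite /star_gate (negbTE yB).
case/star_blocksP: BBB yB => [[u [uY nuv ->]]|[y' y'Y ->]] yB.
  rewrite petal_root; have [yY|yY] := boolP (y \in Y).
    move: xy; rewrite Yadj // => /eqP->; rewrite (negbTE bY) /=.
    by case: ifP.
  have nyv : y != v by apply: contraNneq yB => ->; rewrite petal_root.
  have [xB|xB] /= := ifPn.
    have [//|nxv] := eqVneq x v; case/negP: yB; move: xB; rewrite !inE yY (negbTE nxv) (negbTE nyv) /=.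
    by case/andP=> xY; rewrite (labelP xY yY).
  case: ifP => // /andP[xY bB]; move: xy; rewrite adj_sym Yadj // => /eqP yb.
  by rewrite yb bB in yB.
have E : (if v \in [set b; y'] then v else b) = b.
  by case: ifP => // /(star_edge_root y'Y).
rewrite E set21 !andbT !if_same; case: ifP => [/set2P[//|xy']|//].
by move: xy; rewrite xy' adj_sym Yadj // => /eqP yb; rewrite yb set21 in yB.
Qed.

Lemma hang_petal u w : w \in petal u -> w != v -> (w != b) || (Y == set0) ->
  hang star_gate (petal u) w = 0.
Proof.
move=> wB nwv H; rewrite /hang (_ : fiber _ _ _ = [set w]) ?cards1 //.
apply/setP=> x; rewrite !inE /star_gate petal_root.
have [xB|xB] := ifPn (x \in petal u); first by rewrite eq_sym.
have nxw : x != w by apply: contraNneq xB => ->.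
rewrite (negbTE nxw); case: ifP => [/andP[xY _]|_]; apply/negbTE; last by rewrite eq_sym.
case/orP: H => [|/eqP Y0]; first by rewrite eq_sym.
by rewrite Y0 inE in xY.
Qed.

Lemma hang_petal_attach : b != v -> hang star_gate (petal b) b = #|Y|.
Proof.
move=> nbv; rewrite /hang (_ : fiber _ _ _ = b |: Y) ?cardsU1 ?bY //.
apply/setP=> x; rewrite !inE /star_gate petal_root petal_self // andbT.
have [xB|xB] := ifPn (x \in petal b).
  by move: xB; rewrite inE => /andP[/negbTE-> _]; rewrite orbF.
have nxb : x != b by apply: contraNneq xB => ->; rewrite petal_self.
by rewrite (negbTE nxb) /=; case: ifP => _; rewrite ?eqxx // eq_sym (negbTE nbv).
Qed.

Lemma pendent_star_edge y : y \in Y -> pendent star_gate [set b; y].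
Proof.
move=> yY; apply/pendentP; exists b; rewrite ?set21 // => w /set2P[->|->]; first by rewrite eqxx.
move=> nyb; rewrite /hang (_ : fiber _ _ _ = [set y]) ?cards1 //.
apply/setP=> x; rewrite !inE /star_gate set21 andbT; case: ifP => // xB.
have nxy : x != y by apply: contraFneq xB => ->; rewrite set22.
rewrite (negbTE nxy); apply/negbTE; rewrite eq_sym in nyb.
case: ifP => // _; case: ifP => [/(star_edge_root yY) vb|//].
by rewrite vb.
Qed.

Lemma pendent_petal u : (b \notin petal u) || (Y == set0) -> pendent star_gate (petal u).
Proof.
move=> H; apply/pendentP; exists v => [|w wB nwv]; first exact: petal_root.
apply: hang_petal => //; case/orP: H => [bB|->]; last by rewrite orbT.
by apply/orP; left; apply: contraNneq bB => <-.
Qed.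

(** Labels [1, ..., t] are reserved for the petals that are cycles, with one representative each;
    pendent edges at [v] have larger labels. *)
Lemma star_cycles t (rep : 'I_t -> G) :
  (forall k, [/\ rep k \notin Y, rep k != v & label (rep k) = k.+1]) ->
  (forall u, u \notin Y -> u != v -> (2 < #|petal u|) = (0 < label u <= t)) ->
  #|cycles G| = t.
Proof.
move=> repP lab; rewrite (gated_cycles star_gated) -[RHS]card_ord.
rewrite -(card_imset (f := fun k => petal (rep k))) => [|k k'].
  apply: eq_card => B; rewrite [LHS]inE; apply/idP/imsetP => [/andP[/star_blocksP]|[k _ ->]].
    case=> [[u [uY nuv ->]]|[y yY ->]]; last by rewrite cards2; case: (_ != _).
    rewrite lab //; case El: (label u) => [//|k] /= kt; exists (Ordinal kt) => //.
    by have [_ _ Er] := repP (Ordinal kt); apply/setP=> x; rewrite !inE Er El.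
  have [kY nkv Ek] := repP k; rewrite lab // Ek ltn_ord /= andbT.
  by apply/star_blocksP; left; exists (rep k).
have [kY nkv Ek] := repP k; have [kY' nkv' Ek'] := repP k'.
move/setP/(_ (rep k)); rewrite petal_self // inE kY (negbTE nkv) Ek Ek' /= => /esym/eqP[].
exact: val_inj.
Qed.

End Star.

Lemma nat_graph_adj n f (x y : nat_graph n f) : x < y -> (x -- y) = f x y.
Proof. by move=> xy; rewrite /= /nat_adj /= xy ltnNge (ltnW xy) orbF. Qed.

(* The vertices below m form a copy of G0 m t; the others are pendent at vertex 1. *)
Section Triangles.
Variables (n m t : nat) (f : nat -> nat -> bool).
Hypotheses (t_m : t.*2 < m) (m2 : 2 <= m) (mn : m <= n).
Hypothesis f_core : forall i j, i < j < m -> f i j = G0_edge t i j.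
Hypothesis f_pend : forall i j, i < j < n -> m <= j -> f i j = (i == 1).

Let G := nat_graph n f.
Let n0 : 0 < n. Proof. lia. Qed.
Let n1 : 1 < n. Proof. lia. Qed.
Let v : G := Ordinal n0.
Let b : G := Ordinal n1.
Let Y : {set G} := [set j : 'I_n | m <= j].
(** The triangle [{0, 2k-1, 2k}] gets label [k]; a pendent vertex labels itself, by a number above
    [2 t]. *)
Let label (x : G) : nat := if x <= t.*2 then uphalf x else x.

Let adj0 (x : G) : x < m -> 0 < x -> v -- x.
Proof. by move=> xm x0; rewrite (nat_graph_adj (x := v)) // f_core //= x0 xm. Qed.

Lemma tri_root_core : v \notin Y.
Proof. by rewrite inE /= -ltnNge; lia. Qed.

Lemma tri_attach_core : b \notin Y.
Proof. by rewrite inE /= -ltnNge. Qed.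

Lemma tri_pend (x y : G) : y \in Y -> (x -- y) = (x == b).
Proof.
rewrite inE => my; rewrite -val_eqE; case: (ltngtP x y) => [xy|yx|/val_inj->].
- by rewrite nat_graph_adj // f_pend ?xy ?ltn_ord.
- rewrite adj_sym nat_graph_adj // f_pend ?yx ?ltn_ord //; last by apply: leq_trans my (ltnW yx).
  by apply/eqP/eqP => /=; lia.
by rewrite adj_irr; apply/esym/eqP => /=; lia.
Qed.

Lemma tri_label (x y : G) : x \notin Y -> y \notin Y -> x != v -> y != v ->
  x -- y -> label x = label y.
Proof.
move=> + + + + xy; wlog lt : x y xy / x < y.
  move=> W xm ym x0 y0; case: (ltngtP x y) => [lt|lt|/val_inj->//]; first exact: W.
  by apply/esym/W; rewrite // adj_sym.
rewrite !inE -!ltnNge -!val_eqE /= => xm ym x0 y0.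
move: xy; rewrite nat_graph_adj // f_core ?lt //.
rewrite /G0_edge (negbTE x0) /= => /and3P[ox /eqP yx yt].
rewrite /label yt yx (_ : x <= t.*2); lia.
Qed.

Lemma tri_petal u : u \notin Y -> u != v ->
  if u <= t.*2 then cycle_block (petal v Y label u) /\ #|petal v Y label u| = 3
  else edge_block (petal v Y label u) /\ #|petal v Y label u| = 2.
Proof.
rewrite !inE -!ltnNge -!val_eqE /= => um u0; case: leqP => ut; last first.
  have E : petal v Y label u = [set v; u].
    apply/setP=> x; rewrite !inE -ltnNge -!val_eqE /label /=.
    by case: (leqP u t.*2); case: (leqP x t.*2); lia.
  have vu : v -- u by apply: adj0; lia.
  by rewrite E cards2 (edge_neq vu); split=> //; exists v, u.
have pn : (uphalf u).*2.-1 < n by lia.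
have qn : (uphalf u).*2 < n by lia.
pose p : G := Ordinal pn; pose q : G := Ordinal qn.
have E : petal v Y label u = [set v; p; q].
  apply/setP=> x; rewrite !inE -ltnNge -!val_eqE /label /= ut.
  by case: (leqP x t.*2); lia.
have vp : v -- p by apply: adj0 => /=; lia.
have vq : v -- q by apply: adj0 => /=; lia.
have pq : p -- q.
  rewrite nat_graph_adj /=; last by lia.
  by rewrite f_core /G0_edge; lia.
rewrite E; split; first by apply: triangle_cycle_block => //; rewrite adj_sym.
by rewrite -setUA !cardsU1 cards1 !inE negb_or (edge_neq vp) (edge_neq vq) (edge_neq pq).
Qed.

Lemma tri_petalP u : u \notin Y -> u != v ->
  edge_block (petal v Y label u) \/ cycle_block (petal v Y label u).
Proof. by move=> uY uv; have := tri_petal uY uv; case: ifP => _ []; [right|left]. Qed.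

Lemma tri_gated : gated (star_blocks v b Y label) (star_gate v b Y).
Proof.
exact: star_gated tri_root_core tri_attach_core tri_pend tri_label tri_petalP.
Qed.

Lemma tri_cycles : #|cycles G| = t.
Proof.
(* [2 k + 2] is the even corner of the triangle labelled [k + 1]. *)
have kn (k : 'I_t) : k.*2.+2 < n by case: k => k /=; lia.
apply: (star_cycles tri_root_core tri_attach_core tri_pend tri_label tri_petalP
  (rep := fun k => Ordinal (kn k) : G)).
  move=> [k kt]; rewrite inE -ltnNge -val_eqE /= /label /=; split=> //; first by lia.
  by rewrite (_ : k.*2.+2 <= t.*2); lia.
move=> u uY uv; have := tri_petal uY uv.
move: uv uY; rewrite !inE -!ltnNge -!val_eqE /= /label => u0 um.
by case: ifP => ut [_ ->]; lia.
Qed.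

Lemma tri_small u : u \notin Y -> u != v -> #|petal v Y label u| <= 3.
Proof. by move=> uY uv; have := tri_petal uY uv; case: ifP => _ [_ ->]. Qed.

Lemma tri_profile0 : m = n -> profile0 (star_blocks v b Y label) (star_gate v b Y).
Proof.
move=> E B /star_blocksP[[u [uY uv ->]]|[y]]; last first.
  by rewrite inE E leqNgt ltn_ord.
split; last exact: tri_small.
apply: (pendent_petal tri_root_core); apply/orP; right; apply/eqP/setP=> y.
by rewrite !inE E leqNgt ltn_ord.
Qed.

Lemma tri_profile4 : 0 < t -> m.+1 = n ->
  profile4 (star_blocks v b Y label) (star_gate v b Y) n (petal v Y label b).
Proof.
move=> t0 E; have bv : b != v by rewrite -val_eqE.
have mltn : m < n by rewrite -E.
have Y1 : #|Y| = 1.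
  rewrite -(cards1 (Ordinal mltn : G)); apply: eq_card => x.
  by rewrite !inE -val_eqE /=; have : x < n by []; lia.
have bY := tri_attach_core; pose B0 := petal v Y label b.
have B03 : #|B0| = 3.
  by have := tri_petal bY bv; rewrite ifT => [[]|] //=; lia.
have BB0 : B0 \in star_blocks v b Y label by apply/star_blocksP; left; exists b.
have vB0 : v \in B0 by rewrite !inE !eqxx /= -ltnNge; lia.
have bB0 : b \in B0 by rewrite inE bY eqxx orbT.
have vb : v != b by rewrite eq_sym.
have [c BE /andP[nvc nbc]] := card3_set B03 vB0 bB0 vb.
have cB0 : c \in B0 by rewrite BE !inE eqxx !orbT.
have hb : hang (star_gate v b Y) B0 b = 1.
  by rewrite (hang_petal_attach _ tri_root_core bY) ?Y1.
have hc : hang (star_gate v b Y) B0 c = 0.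
  by apply: (hang_petal tri_root_core) => //; rewrite eq_sym ?nvc ?nbc.
split=> //.
- exists v, b, c; split=> //; first by rewrite /= !inE negb_or vb nvc nbc.
  have := sum_hang tri_gated BB0; rewrite card_ord B03.
  rewrite (eq_bigl [in [set v; b; c]]); last by move=> x; rewrite BE.
  rewrite big_set3 //= hb hc. by rewrite -/B0; lia.
move=> B /star_blocksP[[u [uY uv ->]]|[y yY ->]] nB; last first.
  split; first exact: (pendent_star_edge b tri_root_core yY).
  by rewrite cards2; case: (_ != _).
split; last exact: tri_small.
apply: (pendent_petal tri_root_core); rewrite (_ : b \notin _) //.
apply: contra nB; rewrite inE bY (negbTE bv) /= => /eqP lbu.
by apply/eqP/setP=> x; rewrite !inE lbu.
Qed.

End Triangles.

Section Square.
Variables (n t : nat).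
Hypotheses (t0 : 0 < t) (tn : t.*2.+2 <= n).

Let G := G5 n t.
Let n0 : 0 < n. Proof. lia. Qed.
Let v : G := Ordinal n0.
(** Label [1] is the 4-cycle, label [k] the triangle [{0, 2k, 2k+1}]. As no vertex was moved, [Y] is
    empty below and [v] itself serves as [b]. *)
Let label (x : G) : nat := if x <= 3 then 1 else if x <= t.*2.+1 then x./2 else x.

Let vY : v \notin (set0 : {set G}). Proof. by rewrite inE. Qed.

Let Yadj (x y : G) : y \in set0 -> (x -- y) = (x == v).
Proof. by rewrite inE. Qed.

Lemma square_label (x y : G) : x \notin set0 -> y \notin set0 -> x != v -> y != v ->
  x -- y -> label x = label y.
Proof.
move=> _ _ + + xy; wlog lt : x y xy / x < y.
  move=> W x0 y0; case: (ltngtP x y) => [lt|lt|/val_inj->//]; first exact: W.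
  by apply/esym/W; rewrite // adj_sym.
rewrite -!val_eqE /= => x0 y0; move: xy; rewrite nat_graph_adj // /G5_edge (negbTE x0) /=.
rewrite /label => adj_xy.
by case: (leqP x 3) => x3; case: (leqP y 3) => y3;
   case: (leqP x t.*2.+1) => xt; case: (leqP y t.*2.+1) => yt; lia.
Qed.

Let adj0 (x : G) : 0 < x -> x != 2 :> nat -> v -- x.
Proof. by move=> x0 x2; rewrite (nat_graph_adj (x := v)) // /G5_edge /= x2. Qed.

Let n4 : 4 <= n. Proof. lia. Qed.
Let a1 : G := Ordinal (ltnW (ltnW n4) : 1 < n).
Let a2 : G := Ordinal (ltnW n4 : 2 < n).
Let a3 : G := Ordinal (n4 : 3 < n).

Lemma square_petal4 (u : G) : u <= 3 -> petal v set0 label u = [set v; a1; a2; a3].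
Proof.
move=> u3; apply/setP=> x; rewrite !inE -!val_eqE /label /= u3.
by case: (leqP x 3) => x3; case: (leqP x t.*2.+1) => xt; lia.
Qed.

Lemma square_cycle4 : cycle_block [set v; a1; a2; a3].
Proof. exact: square_cycle_block. Qed.

Lemma square_petal (u : G) : u != v ->
  if u <= 3 then cycle_block (petal v set0 label u) /\ #|petal v set0 label u| = 4
  else if u <= t.*2.+1 then cycle_block (petal v set0 label u) /\ #|petal v set0 label u| = 3
  else edge_block (petal v set0 label u) /\ #|petal v set0 label u| = 2.
Proof.
rewrite -val_eqE /= => u0; case: leqP => u3.
  rewrite square_petal4 //; split; first exact: square_cycle4.
  by rewrite -!setUA !cardsU1 cards1 !inE.
case: leqP => ut; last first.
  have E : petal v set0 label u = [set v; u].
    apply/setP=> x; rewrite !inE -!val_eqE /label /= (leqNgt u 3) u3 (leqNgt u t.*2.+1) ut /=.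
    by case: (leqP x 3) => x3; case: (leqP x t.*2.+1) => xt; lia.
  have vu : v -- u by apply: adj0; lia.
  by rewrite E cards2 (edge_neq vu); split=> //; exists v, u.
have pn : u./2.*2 < n by lia.
have qn : u./2.*2.+1 < n by lia.
pose p : G := Ordinal pn; pose q : G := Ordinal qn.
have E : petal v set0 label u = [set v; p; q].
  apply/setP=> x; rewrite !inE -!val_eqE /label /= ut (leqNgt u 3) u3 /=.
  by case: (leqP x 3) => x3; case: (leqP x t.*2.+1) => xt; lia.
have vp : v -- p by apply: adj0 => /=; lia.
have vq : v -- q by apply: adj0 => /=; lia.
have pq : p -- q by rewrite nat_graph_adj /= /G5_edge; lia.
rewrite E; split; first by apply: triangle_cycle_block => //; rewrite adj_sym.
by rewrite -setUA !cardsU1 cards1 !inE negb_or (edge_neq vp) (edge_neq vq) (edge_neq pq).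
Qed.

Lemma square_petalP u : u \notin set0 -> u != v ->
  edge_block (petal v set0 label u) \/ cycle_block (petal v set0 label u).
Proof. by move=> _ /square_petal; do 2?case: ifP => _; case; [right | right | left]. Qed.

Lemma square_gated : gated (star_blocks v v set0 label) (star_gate v v set0).
Proof. exact: star_gated vY vY Yadj square_label square_petalP. Qed.

Lemma square_cycles : #|cycles G| = t.
Proof.
(* For [k = 0] this is vertex 2 of the 4-cycle, otherwise the even corner of the triangle labelled
   [k + 1]. *)
have kn (k : 'I_t) : k.*2.+2 < n by case: k => k /=; lia.
apply: (star_cycles vY vY Yadj square_label square_petalP
  (rep := fun k => Ordinal (kn k) : G)).
  move=> [k kt]; rewrite inE -val_eqE /= /label /=; split=> //.
  by case: (leqP k.*2.+2 3) => k1; case: (leqP k.*2.+2 t.*2.+1) => k2; lia.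
move=> u _ uv; have := square_petal uv; move: uv; rewrite -val_eqE /= /label => u0.
case: (leqP u 3) => u3; first by case=> _ ->; lia.
by case: (leqP u t.*2.+1) => ut [_ ->]; lia.
Qed.

Lemma square_profile5 :
  profile5 (star_blocks v v set0 label) (star_gate v v set0) (petal v set0 label a1).
Proof.
have P u : pendent (star_gate v v set0) (petal v set0 label u).
  by apply: (pendent_petal vY); rewrite eqxx orbT.
split=> //.
- by apply/star_blocksP; left; exists a1; rewrite inE.
- by have [] := square_petal (u := a1) isT.
move=> B /star_blocksP[[u [_ uv ->]]|[y]]; last by rewrite inE.
move=> nu; split=> //; have := square_petal uv; case: leqP => [u3|_].
  by rewrite !square_petal4 // eqxx in nu.
by case: ifP => _ [_ ->].
Qed.
End Square.

(** * Cycle numbers under isomorphism, and the comparison of all cacti *)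

Lemma isomorphic_deg (G H : sgraph) (f : G -> H) : bijective f ->
  (forall x y, (f x -- f y) = (x -- y)) -> forall x, deg (f x) = deg x.
Proof.
move=> fbij fadj x; rewrite /deg -(card_imset _ (bij_inj fbij)); apply: eq_card => y.
have [g fK gK] := fbij; rewrite -(gK y) inE fadj mem_imset ?inE //; exact: bij_inj.
Qed.

(** By [sum_deg_total] the cycle number can be read off from the degree sum and the order, so only
    degrees have to be transported. *)
Lemma isomorphic_cycles (G H : sgraph) BB pi BB' pi' :
  @gated G BB pi -> @gated H BB' pi' -> 0 < #|G| -> isomorphic G H ->
  #|cycles G| = #|cycles H|.
Proof.
move=> Gg Hg G0 [f fbij fadj]; have GH : #|G| = #|H| by apply: bij_eq_card fbij.
have := sum_deg_total Gg G0; have := sum_deg_total Hg; rewrite -GH => /(_ G0).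
rewrite (reindex f) /=; last exact: onW_bij.
by under eq_bigr do rewrite (isomorphic_deg fbij fadj); lia.
Qed.

Lemma gated_Cact (G : sgraph) BB pi n t : @gated G BB pi -> 1 < n ->
  #|G| = n -> #|cycles G| = t -> Cact G n t.
Proof.
move=> Gg n1 Gn Gt; split=> //; first exact: (gated_conn Gg).
by apply: (gated_cactus Gg); rewrite Gn.
Qed.

Lemma G0_gated n t : 2 <= n -> 2 * t + 1 <= n ->
  exists BB pi, [/\ @gated (G0 n t) BB pi, #|cycles (G0 n t)| = t & profile0 BB pi].
Proof.
move=> n2 tn; have tn' : t.*2 < n by lia.
have core i j : i < j < n -> G0_edge t i j = G0_edge t i j by [].
(* Vacuous: with [m = n] no vertex is pendent at vertex 1. *)
have pend i j : i < j < n -> n <= j -> G0_edge t i j = (i == 1) by lia.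
eexists; eexists; split.
- exact: (tri_gated tn' n2 (leqnn n) core pend).
- exact: (tri_cycles tn' n2 (leqnn n) core pend).
exact: (@tri_profile0 n n t _ tn' n2 (leqnn n) core).
Qed.

Lemma G4_gated n t : 0 < t -> 2 * t + 2 <= n ->
  exists BB pi B0, [/\ @gated (G4 n t) BB pi, #|cycles (G4 n t)| = t & profile4 BB pi n B0].
Proof.
move=> t0 tn; have tn' : t.*2 < n.-1 by lia.
have n2 : 2 <= n.-1 by lia.
have core i j : i < j < n.-1 -> G4_edge n t i j = G0_edge t i j.
  by move=> /andP[_ jn]; rewrite /G4_edge ltn_eqF.
have pend i j : i < j < n -> n.-1 <= j -> G4_edge n t i j = (i == 1).
  by move=> /andP[ij jn] nj; rewrite /G4_edge (_ : j == n.-1) //; lia.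
eexists; eexists; eexists; split.
- exact: (tri_gated tn' n2 (leq_pred n) core pend).
- exact: (tri_cycles tn' n2 (leq_pred n) core pend).
apply: (@tri_profile4 n n.-1 t _ tn' n2 (leq_pred n) core pend) => //; lia.
Qed.

Lemma G5_gated n t : 0 < t -> 2 * t + 2 <= n ->
  exists BB pi B0, [/\ @gated (G5 n t) BB pi, #|cycles (G5 n t)| = t & profile5 BB pi B0].
Proof.
move=> t0 tn; have tn' : t.*2.+2 <= n by lia.
eexists; eexists; eexists; split.
- exact: (square_gated t0 tn').
- exact: (square_cycles t0 tn').
exact: (@square_profile5 n t t0 tn').
Qed.

Lemma Cact_small_DR (R : realFieldType) (n t : nat) (G : sgraph) : 25 <= n -> Cact G n t ->
  [\/ isomorphic G (G0 n t),
      isomorphic G (G5 n t) /\ DR R G = (min_DR R n t + G5_excess R n t)%R,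
      isomorphic G (G4 n t) /\ DR R G = (min_DR R n t + G4_excess R n t)%R |
      (min_DR R n t + G4_excess R n t < DR R G)%R].
Proof.
move=> n25 [Gc Gk Gn Gt]; have [pi Gg] := cactus_gated Gc Gk.
have Gpos : 0 < #|G| by lia.
have [P|[B0 P]|[B0 P]|lt] := DR_profiles R Gg Gn Gt n25; last by constructor 4.
(* [t'] comes from the enumeration of [G]; comparing cycle numbers across the isomorphism gives
   [t' = t], and likewise in the other two cases. *)
- have [t' tn iso] := profile0_iso Gg Gn n25 P.
  have [|BB [pi' [Hg Ht _]]] := @G0_gated n t' _ tn; first by lia.
  by constructor 1; rewrite -Gt (isomorphic_cycles Gg Hg Gpos iso) Ht.
- have [t' [t0 tn iso]] := profile5_iso Gg Gn n25 P.
  have [BB [pi' [B1 [Hg Ht _]]]] := G5_gated t0 tn.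
  constructor 2; split; last exact: (profile5_DR R Gg Gn Gt n25 P).
  by rewrite -Gt (isomorphic_cycles Gg Hg Gpos iso) Ht.
have [t' [t0 tn iso]] := profile4_iso Gg Gn P.
have [BB [pi' [B1 [Hg Ht _]]]] := G4_gated t0 tn.
constructor 3; split; last exact: (profile4_DR R Gg Gn Gt n25 P).
by rewrite -Gt (isomorphic_cycles Gg Hg Gpos iso) Ht.
Qed.

(** [2 t + 2] vertices are what [G5] needs, as [1 + 3 + 2 (t - 1)], and also [G4], as [2 t + 1] and
    the moved vertex; with fewer vertices neither graph exists. *)
Theorem theorem5p1 (R : realFieldType) (n t : nat)
    (hn : (25 <= n)%N) (ht : (1 <= t)%N) (hnt : (2 * t + 2 <= n)%N) :
  [/\ Cact (G0 n t) n t, Cact (G5 n t) n t & Cact (G4 n t) n t] /\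
  (DR R (G0 n t) < DR R (G5 n t))%R /\
  (DR R (G5 n t) < DR R (G4 n t))%R /\
  (forall G : sgraph, Cact G n t ->
     ~ isomorphic G (G0 n t) ->
     (DR R (G0 n t) < DR R G)%R) /\
  (forall G : sgraph, Cact G n t ->
     ~ isomorphic G (G0 n t) -> ~ isomorphic G (G5 n t) ->
     (DR R (G5 n t) < DR R G)%R) /\
  (forall G : sgraph, Cact G n t ->
     ~ isomorphic G (G0 n t) -> ~ isomorphic G (G5 n t) ->
     ~ isomorphic G (G4 n t) ->
     (DR R (G4 n t) < DR R G)%R).
Proof.
have card k f : #|nat_graph k f| = k by rewrite card_ord.
have [||BB0 [pi0 [g0 c0 P0]]] := @G0_gated n t; [lia | lia |].
have [BB5 [pi5 [B5 [g5 c5 P5]]]] := G5_gated ht hnt.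
have [BB4 [pi4 [B4 [g4 c4 P4]]]] := G4_gated ht hnt.
have n1 : (1 < n)%N by lia.
have D0 := profile0_DR R g0 (card _ _) c0 hn P0.
have D5 := profile5_DR R g5 (card _ _) c5 hn P5.
have D4 := profile4_DR R g4 (card _ _) c4 hn P4.
have nR : (25 <= n%:R :> R)%R by rewrite ler_nat.
have tR : (0 <= t%:R :> R)%R by rewrite ler0n.
rewrite D0 D5 D4; split.
  split; [exact: (gated_Cact g0 n1 (card _ _) c0)
         | exact: (gated_Cact g5 n1 (card _ _) c5)
         | exact: (gated_Cact g4 n1 (card _ _) c4)].
have lt05 : (0 < G5_excess R n t)%R by rewrite /G5_excess; lra.
have lt54 : (G5_excess R n t < G4_excess R n t)%R by rewrite /G5_excess /G4_excess; lra.
split; first by lra.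
split; first by lra.
split; [|split] => G GC.
- by move=> n0; have [/n0//|[_ ->]|[_ ->]|] := Cact_small_DR R hn GC; lra.
- by move=> n0 n5; have [/n0//|[/n5//]|[_ ->]|] := Cact_small_DR R hn GC; lra.
by move=> n0 n5 n4; have [/n0//|[/n5//]|[/n4//]|] := Cact_small_DR R hn GC.
Qed.
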